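(* The process $\eta=\{\eta(t)\}_{t\in\mathbb R}$ is semi-min-stable with parameter $(3/2,1/3)$: if $\eta_1,\eta_2,\dots$ are i.i.d. copies of $\eta$, then for all $n\in\mathbb N$, $$\{\eta(t)\}_{t\in\mathbb R}\stackrel{d}{=}\Big\{n^{2/3}\min_{j=1,\dots,n}\eta_j\big(t/n^{1/3}\big)\Big\}_{t\in\mathbb R},$$ where $\stackrel{d}{=}$ denotes equality of finite-dimensional distributions.
   Context: A non-negative process $\{Z_t\}_{t\in\mathbb R}$ is called semi-min-stable with parameter $(\alpha,\beta)\in(0,\infty)\times[0,\infty)$ if, for i.i.d. copies $\{Z_i\}_{i\in\mathbb N}$ of $Z$, $\{Z_t\}_{t\in\mathbb R}\stackrel{d}{=}\{n^{1/\alpha}\min_{i=1,\dots,n}Z_{i,t/n^\beta}\}_{t\in\mathbb R}$ (equality of finite-dimensional distributions) for all $n\in\mathbb N$. Tangent process: for $w>0$, the one-sided process is the Markov process on $[0,\infty)$ indexed by $t\ge0$, started at $w$, with transition density $$p_{s,t}(x,y)=\frac{2(t-s)\sqrt y}{\pi\left[(y-x)^2+2(x+y)(t-s)^2+(t-s)^4\right]},\quad s<t,\ x\ge 0,\ y>0.$$ Its two-sided version $\{\mathbb Z^w_t\}_{t\in\mathbb R}$ is defined by taking two independent such processes $\mathbb Z^{w,+},\mathbb Z^{w,-}$ started at $w$, with $\mathbb Z^{w,+}$ càdlàg and $\mathbb Z^{w,-}$ left-continuous with right limits, and setting $\mathbb Z^w_t=\mathbb Z^{w,+}_t$ for $t\ge0$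 and $\mathbb Z^w_t=\mathbb Z^{w,-}_{-t}$ for $t<0$. The process $\eta$: let $\{W_n\}_{n\in\mathbb N}$ be an enumeration of the points of a Poisson point process on $\mathbb R_+$ with intensity $\tfrac32 w^{1/2}dw$; given $\{W_n\}$, let $\mathbb Z_n^{W_n}=\{\mathbb Z^{W_n}_{n,t}\}_{t\in\mathbb R}$, $n\in\mathbb N$, be conditionally independent two-sided tangent processes, the $n$-th starting from $W_n$ (at time $0$). Then $\eta(t)=\inf_{n\in\mathbb N}\mathbb Z^{W_n}_{n,t}$, $t\in\mathbb R$. *)

(* Defs.v *)
From HB Require Import structures.
From mathcomp Require Import all_boot all_order all_algebra finmap.
From mathcomp Require Import all_classical all_reals all_analysis.
From mathcomp Require Import measurable_realfun.
Import Order.TTheory GRing.Theory Num.Theory.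
Import numFieldNormedType.Exports.

Set Implicit Arguments.
Unset Strict Implicit.
Unset Printing Implicit Defensive.

Local Open Scope classical_set_scope.
Local Open Scope ring_scope.

Section general_probability.
Context (R : realType) (d : measure_display) (Om : measurableType d)
  (P : probability Om R).

Definition sigma_gen (d' : measure_display) (T : measurableType d')
    (I : Type) (D : set I) (X : I -> Om -> T) : set (set Om) :=
  <<s [set E | exists i B, [/\ D i, measurable B & E = X i @^-1` B]] >>.

Definition indep (I : choiceType) (F : I -> set (set Om)) : Prop :=
  forall (J : {fset I}) (E : I -> set Om),
    (forall i, i \in J -> F i (E i)) ->
    P (\bigcap_(i in [set` J]) E i) = (\prod_(i <- J) P (E i))%E.

(* [f] is a (nonnegative) version of the conditional probability P(E | G),
   for [G] a sub-sigma-algebra of [measurable]. *)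
Definition is_cond_prob (G : set (set Om)) (E : set Om) (f : Om -> \bar R) :
    Prop :=
  [/\ forall w, (0 <= f w)%E,
      forall B : set (\bar R), measurable B -> G (f @^-1` B) &
      forall A, G A -> (\int[P]_(w in A) f w)%E = P (A `&` E)].

(* P(\bigcap_i E_i | G) = \prod_i P(E_i | G) almost surely. *)
Definition cond_indep (G : set (set Om)) (I : choiceType)
    (F : I -> set (set Om)) : Prop :=
  forall (J : {fset I}) (E : I -> set Om) (f : I -> Om -> \bar R),
    (forall i, i \in J -> F i (E i)) ->
    (forall i, i \in J -> is_cond_prob G (E i) (f i)) ->
    is_cond_prob G (\bigcap_(i in [set` J]) E i)
      (fun w => (\prod_(i <- J) f i w)%E).

(* Number of indices [n] with [W n] in [A], with values in [0, +oo]. *)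
Definition count_points (W : nat -> Om -> R) (A : set R) (w : Om) : \bar R :=
  (\sum_(0 <= n <oo) (\1_A (W n w))%:E)%E.

(* [W] enumerates, with multiplicity, the points of a Poisson point process on
   R_+ = [0, +oo[ with intensity measure [Lambda]. *)
Definition poisson_points (Lambda : set R -> \bar R) (W : nat -> Om -> R) :
    Prop :=
  [/\ (forall n, measurable_fun setT (W n)) /\ (forall n w, 0 <= W n w),
      forall A : set R, measurable A -> (Lambda A < +oo)%E -> forall k : nat,
        P [set w | count_points W A w = (k%:R)%:E] =
        ((fine (Lambda A)) ^+ k / k`!%:R * expR (- fine (Lambda A)))%:E,
      forall A : set R, measurable A -> Lambda A = +oo%E ->
        P [set w | count_points W A w = +oo%E] = 1%E &
      forall (k : nat) (A : 'I_k -> set R),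
        (forall i, measurable (A i)) -> trivIset setT A ->
        indep (fun i : 'I_k =>
          sigma_gen [set: unit] (fun _ : unit => count_points W (A i)))].

End general_probability.

Definition same_fdd (R : realType) (d d' : measure_display)
    (Om : measurableType d) (P : probability Om R) (X : R -> Om -> R)
    (Om' : measurableType d') (P' : probability Om' R) (Y : R -> Om' -> R) :
    Prop :=
  forall (m : nat) (t : m.-tuple R) (B : set (m.-tuple R)), measurable B ->
    P [set w | B [tuple X (tnth t i) w | i < m]] =
    P' [set w | B [tuple Y (tnth t i) w | i < m]].

Definition iid_copies (R : realType) (d d' : measure_display)
    (Om : measurableType d) (P : probability Om R) (X : R -> Om -> R)
    (Om' : measurableType d') (P' : probability Om' R)
    (Y : nat -> R -> Om' -> R) : Prop :=
  [/\ forall j t, measurable_fun setT (Y j t),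
      forall j, same_fdd P X P' (Y j) &
      indep P' (fun j => sigma_gen [set: R] (Y j))].

(* The copies are indexed from 0; as n > 0, the default value [Y 0 _] of the
   iterated minimum is one of its terms. *)
Definition semi_min_stable (R : realType) (d : measure_display)
    (Om : measurableType d) (P : probability Om R) (X : R -> Om -> R)
    (alpha beta : R) : Prop :=
  [/\ 0 < alpha /\ 0 <= beta,
      forall t, measurable_fun setT (X t),
      forall t w, 0 <= X t w &
      forall (d' : measure_display) (Om' : measurableType d')
        (P' : probability Om' R) (Y : nat -> R -> Om' -> R),
        iid_copies P X P' Y ->
        forall n : nat, (0 < n)%N ->
          same_fdd P X P' (fun t w =>
            n%:R `^ alpha^-1 *
            \big[Num.min/Y 0%N (t / n%:R `^ beta) w]_(j < n)
              Y j (t / n%:R `^ beta) w)].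

Section tangent_process.
Context (R : realType).

Definition tangent_density (s t x y : R) : R :=
  2 * (t - s) * Num.sqrt y /
  (pi * ((y - x) ^+ 2 + 2 * (x + y) * (t - s) ^+ 2 + (t - s) ^+ 4)).

Definition tangent_trans (s t x : R) (B : set R) : \bar R :=
  (\int[lebesgue_measure]_(y in B `&` `]0%R, +oo[) (tangent_density s t x y)%:E)%E.

(* Paths are functions on R of which only the restriction to [0, +oo[ is
   meaningful. *)
Definition cadlag (f : R -> R) : Prop :=
  forall t : R, 0 <= t ->
    f x @[x --> t^'+] --> f t /\ (0 < t -> cvg (f x @[x --> t^'-])).

Definition caglad (f : R -> R) : Prop :=
  forall t : R, 0 <= t ->
    cvg (f x @[x --> t^'+]) /\ (0 < t -> f x @[x --> t^'-] --> f t).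

Context (d : measure_display) (Om : measurableType d) (P : probability Om R).

(* Conditionally on the sigma-algebra [G], [X] is a one-sided tangent process
   started at the [G]-measurable point [x0]: a [0, +oo[-valued Markov process
   whose transitions from time s to time t have density [tangent_density s t].
   Conditioning on [G] and on the past is conditioning on their join. The
   unconditional process started at a deterministic [x0] is the case of the
   trivial [G]. *)
Definition tangent_one_sided (G : set (set Om)) (x0 : Om -> R)
    (X : R -> Om -> R) : Prop :=
  [/\ forall t : R, 0 <= t -> measurable_fun setT (X t),
      forall (t : R) (w : Om), 0 <= t -> 0 <= X t w,
      {ae P, forall w, X 0 w = x0 w} &
      forall (s t : R) (B : set R), 0 <= s -> s < t -> measurable B ->
        is_cond_prob P <<s G `|` sigma_gen `[0, s] X >> (X t @^-1` B)
          (fun w => tangent_trans s t (X s w) B)].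

Definition two_sided_path (Xp Xm : R -> Om -> R) (t : R) (w : Om) : R :=
  if 0 <= t then Xp t w else Xm (- t) w.

Definition tangent_two_sided (G : set (set Om)) (x0 : Om -> R)
    (X : R -> Om -> R) : Prop :=
  exists Xp Xm : R -> Om -> R,
  [/\ tangent_one_sided G x0 Xp /\ (forall w, cadlag (Xp ^~ w)),
      tangent_one_sided G x0 Xm /\ (forall w, caglad (Xm ^~ w)),
      cond_indep P G (fun b : bool =>
        sigma_gen [set t : R | 0 <= t] (if b then Xp else Xm)) &
      forall t w, X t w = two_sided_path Xp Xm t w].

Definition eta_intensity (A : set R) : \bar R :=
  (\int[lebesgue_measure]_(w in A `&` `[0%R, +oo[)
     ((3 / 2) * w `^ (1 / 2))%:E)%E.

Definition eta (Z : nat -> R -> Om -> R) (t : R) (w : Om) : R :=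
  inf (range (fun n => Z n t w)).

(* [W] enumerates a Poisson point process of intensity (3/2) w^(1/2) dw and,
   given [W], the [Z n] are independent two-sided tangent processes, the n-th
   one started at [W n]. *)
Definition eta_construction (W : nat -> Om -> R) (Z : nat -> R -> Om -> R) :
    Prop :=
  let G := sigma_gen [set: nat] W in
  [/\ poisson_points P eta_intensity W,
      forall n, tangent_two_sided G (W n) (Z n) &
      cond_indep P G (fun n : nat => sigma_gen [set: R] (Z n))].

End tangent_process.

(* Main.v *)
Require Import Defs.
From mathcomp Require Import all_boot all_order all_algebra finmap.
From mathcomp Require Import all_classical all_reals all_analysis.
From mathcomp Require Import measurable_realfun.
From mathcomp Require Import ring lra.
Import Order.TTheory GRing.Theory Num.Theory.
Import numFieldNormedType.Exports.

(** Given [W], the events [Z n t_i >= y_i for all i] are independent in [n] with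
    conditional probability [h (W n)], where [h w] is the probability of the
    event for the two-sided tangent process started at [w], an iterated
    integral of the transition density.  The Laplace functional of the Poisson
    process of points [W] then gives
      P (eta t_i >= y_i for all i) = exp (- Q),
      Q = \int (1 - h w) (3/2) w^(1/2) dw.
    Dividing times by [c = n^(1/3)] and positions by [c^2] leaves [h] invariant,
    because the transition density scales by [c^2], whereas the intensity
    w^(1/2) dw contributes a factor [c^(-3) = 1/n] to [Q]; taking the minimum of
    [n] independent copies multiplies [Q] by [n].  Orthants form a pi-system
    generating the sigma-algebra of tuples, so these probabilities determine the
    finite-dimensional distributions. *)

Set Implicit Arguments.
Unset Strict Implicit.
Unset Printing Implicit Defensive.

Local Open Scope classical_set_scope.
Local Open Scope ring_scope.

(** * Induction over nonnegative measurable functions *)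

Section measurable_induction.
Context (R : realType).
Local Open Scope ereal_scope.

Import HBNNSimple.

(** Independence, conditional probabilities and the Markov property are given for events only, so
    every statement about functions is won from indicators by closure under sums, multiples and
    increasing limits.

    Three infinities shape the calculations. The Laplace functional is applied to [- ln h], which is
    [+oo] where [h] vanishes, and [Q] is never shown to be finite; hence the exponential and the
    logarithm on extended reals, with [expeR] sending [-oo] to 0. The counts have Poisson weights
    only on sets of finite intensity; hence functions truncated to bounded intervals. Conditional
    independence covers finitely many [n] at a time; hence a limit over the first [N] processes.

    The orthants are closed lower ones because weak lower bounds pass through the infimum defining
    [eta] in both directions. The copies of [eta] live on another probability space and share only
    its finite-dimensional distributions, so orthant probabilities are all that is transferred to
    them. *)

Lemma ge0_measurable_ind d (T : measurableType d) (Phi : (T -> \bar R) -> Prop) :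
  (forall A, measurable A -> Phi (fun x => (\1_A x)%:E)) ->
  (forall f g, measurable_fun setT f -> (forall x, 0 <= f x) ->
    measurable_fun setT g -> (forall x, 0 <= g x) ->
    Phi f -> Phi g -> Phi (fun x => f x + g x)) ->
  (forall (k : R) f, (0 <= k)%R ->
    measurable_fun setT f -> (forall x, 0 <= f x) ->
    Phi f -> Phi (fun x => k%:E * f x)) ->
  (forall f : (T -> \bar R)^nat, (forall n, measurable_fun setT (f n)) ->
    (forall n x, 0 <= f n x) -> (forall x, nondecreasing_seq (f ^~ x)) ->
    (forall n, Phi (f n)) -> Phi (fun x => limn (f ^~ x))) ->
  forall f, measurable_fun setT f -> (forall x, 0 <= f x) -> Phi f.
Proof.
move=> Pind PD PZ Plim f mf f0.
pose g := nnsfun_approx measurableT mf.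
have -> : f = fun x => limn (fun n => (g n x)%:E).
  apply/funext => x; apply/esym/cvg_lim => //.
  exact: cvg_nnsfun_approx.
apply: (Plim (fun n x => (g n x)%:E)) => //.
- by move=> n; exact/measurable_EFinP.
- by move=> n x; rewrite lee_fin.
- by move=> x m n mn; rewrite lee_fin; exact/lefP/nd_nnsfun_approx.
move=> n.
have -> : (fun x => (g n x)%:E) = fun x =>
    \sum_(i <- fset_set (range (g n))) ((i%:E * (\1_(g n @^-1` [set i]) x)%:E)).
  apply/funext => x; rewrite fimfunE fsbig_finite//= -sumEFin.
  by apply: eq_bigr => i _; rewrite EFinM.
have : forall i, i \in fset_set (range (g n)) -> (0 <= i)%R.
  by move=> i; rewrite in_fset_set// inE => -[x _ <-].
(* The induction on the list of values carries measurability and nonnegativity along with [Phi],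
   since closure under addition asks for both. *)
suff H (s : seq R) : (forall i, i \in s -> (0 <= i)%R) ->
    [/\ measurable_fun setT (fun x =>
      \sum_(i <- s) ((i%:E * (\1_(g n @^-1` [set i]) x)%:E))),
     (forall x, 0 <= \sum_(i <- s) ((i%:E * (\1_(g n @^-1` [set i]) x)%:E))) &
     Phi (fun x => \sum_(i <- s) ((i%:E * (\1_(g n @^-1` [set i]) x)%:E)))].
  by move=> ?; have [] := H (fset_set (range (g n))).
elim: s => [_|a s IH].
  under eq_fun do rewrite big_nil; split => //.
  - by move=> x; rewrite big_nil.
  - have -> : (fun=> 0) = (fun x : T => (\1_set0 x)%:E : \bar R).
      by apply/funext => x; rewrite indicE in_set0.
    exact: Pind.
move=> has; have a0 : (0 <= a)%R by apply: has; rewrite mem_head.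
have [|ms s0 Phis] := IH; first by move=> i si; apply: has; rewrite in_cons si orbT.
have ma : measurable_fun setT (fun x => (\1_(g n @^-1` [set a]) x)%:E : \bar R).
  exact/measurable_EFinP.
have mZ : measurable_fun setT (fun x => a%:E * (\1_(g n @^-1` [set a]) x)%:E).
  exact: measurable_funeM.
have Z0 x : 0 <= a%:E * (\1_(g n @^-1` [set a]) x)%:E.
  by rewrite mule_ge0// lee_fin.
under eq_fun do rewrite big_cons; split.
- exact: emeasurable_funD.
- by move=> x; rewrite big_cons adde_ge0.
- apply: PD => //; apply: PZ => //.
  exact: Pind.
Qed.

(** Used to free one factor of a product from being an indicator: [u] is then the product of the
    other factors and [v] the constant product of their means. *)
Lemma eq_integral_comp_weight d d' (Om : measurableType d)
    (T : measurableType d') (mu : {measure set Om -> \bar R}) (X : Om -> T)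
    (u v : Om -> \bar R) :
  measurable_fun setT X ->
  measurable_fun setT u -> (forall w, 0 <= u w) ->
  measurable_fun setT v -> (forall w, 0 <= v w) ->
  (forall B, measurable B ->
    \int[mu]_w ((\1_B (X w))%:E * u w) = \int[mu]_w ((\1_B (X w))%:E * v w)) ->
  forall f, measurable_fun setT f -> (forall x, 0 <= f x) ->
  \int[mu]_w (f (X w) * u w) = \int[mu]_w (f (X w) * v w).
Proof.
move=> mX mu0 u0 mv v0 H.
apply: (@ge0_measurable_ind _ T (fun f =>
  \int[mu]_w (f (X w) * u w) = \int[mu]_w (f (X w) * v w))) => //.
- move=> f g mf f0 mg g0 IHf IHg.
  have E (z : Om -> \bar R) : measurable_fun setT z -> (forall w, 0 <= z w) ->
      \int[mu]_w ((f (X w) + g (X w)) * z w) =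
      \int[mu]_w (f (X w) * z w) + \int[mu]_w (g (X w) * z w).
    move=> mz z0; rewrite -ge0_integralD//.
    + by apply: eq_integral => w _; rewrite ge0_muleDl.
    + by move=> w _; rewrite mule_ge0.
    + by apply: emeasurable_funM => //; exact: measurableT_comp mX.
    + by move=> w _; rewrite mule_ge0.
    + by apply: emeasurable_funM => //; exact: measurableT_comp mX.
  by rewrite !E// IHf IHg.
- move=> k f k0 mf f0 IH.
  have E (z : Om -> \bar R) : measurable_fun setT z -> (forall w, 0 <= z w) ->
      \int[mu]_w (k%:E * f (X w) * z w) = k%:E * \int[mu]_w (f (X w) * z w).
    move=> mz z0; rewrite -ge0_integralZl_EFin//.
    + by apply: eq_integral => w _; rewrite muleA.
    + by move=> w _; rewrite mule_ge0.
    + by apply: emeasurable_funM => //; exact: measurableT_comp mX.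
  by rewrite !E// IH.
- move=> f mf f0 ndf IH.
  have E (z : Om -> \bar R) : measurable_fun setT z -> (forall w, 0 <= z w) ->
      \int[mu]_w (limn (f ^~ (X w)) * z w) =
      limn (fun n => \int[mu]_w (f n (X w) * z w)).
    move=> mz z0; rewrite -monotone_convergence//.
    + apply: eq_integral => w _; apply/esym/cvg_lim => //.
      have cf : f ^~ (X w) @ \oo --> ereal_sup (range (f ^~ (X w))).
        exact: ereal_nondecreasing_cvgn.
      have zw := z0 w; move: (z w) zw => [r r0| _|//].
        rewrite muleC; under eq_fun do rewrite muleC.
        rewrite (cvg_lim _ cf)//; exact: cvgeZl.
      (* Here the weight is [+oo], and multiplication by it is not continuous at 0: either every
         [f n (X w)] is 0, or the products are eventually [+oo]. *)
      rewrite (cvg_lim _ cf)//.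
      have [/eqP s0|s0] := eqVneq (ereal_sup (range (f ^~ (X w)))) 0.
        have fz n : f n (X w) = 0.
          apply/eqP; rewrite eq_le f0 andbT -(eqP s0).
          by apply: ereal_sup_ubound; exists n.
        rewrite (eqP s0) mul0e; under eq_fun do rewrite fz mul0e.
        exact: cvg_cst.
      have sp : 0 < ereal_sup (range (f ^~ (X w))).
        rewrite lt_neqAle eq_sym s0/= (le_trans (f0 0%N (X w)))//.
        by apply: ereal_sup_ubound; exists 0%N.
      rewrite gt0_muley//.
      have [_ [n _ <-] fn] := ereal_sup_gt sp.
      apply: cvg_near_cst; exists n => // m /= nm.
      by rewrite gt0_muley// (lt_le_trans fn)// (ndf (X w) _ _ nm).
    + by move=> n; apply: emeasurable_funM => //; exact: measurableT_comp mX.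
    + by move=> n w _; rewrite mule_ge0.
    + by move=> w _ m n mn; rewrite lee_wpmul2r// (ndf (X w) m n mn).
  by rewrite !E//; under eq_fun do rewrite IH.
Qed.

End measurable_induction.

(** * Independence: from events to products of functions *)

Section sigma_gen_indep.
Context (R : realType) (d : measure_display) (Om : measurableType d)
  (P : probability Om R).
Local Open Scope ereal_scope.

Lemma sigma_genI (G : set (set Om)) A B :
  <<s G >> A -> <<s G >> B -> <<s G >> (A `&` B).
Proof. exact: (@measurableI _ (g_sigma_algebraType G)). Qed.

Lemma sigma_gen_preimage d' (T : measurableType d') (I : Type) (D : set I)
    (X : I -> Om -> T) i B :
  D i -> measurable B -> sigma_gen D X (X i @^-1` B).
Proof. by move=> Di mB; apply: sub_sigma_algebra; exists i, B. Qed.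

Lemma sigma_gen_measurable d' (T : measurableType d') (I : Type) (D : set I)
    (X : I -> Om -> T) :
  (forall i, D i -> measurable_fun setT (X i)) -> sigma_gen D X `<=` measurable.
Proof.
move=> mX; apply: smallest_sub; first exact: sigma_algebra_measurable.
by move=> _ [i [B [Di mB ->]]]; rewrite -[_ @^-1` _]setTI; exact: mX.
Qed.

Lemma sigma_gen_le_all (I : eqType) (D : set I) (X : I -> Om -> R)
    (l : seq (I * R)) :
  (forall p, p \in l -> D p.1) ->
  sigma_gen D X [set w | forall p, p \in l -> (p.2 <= X p.1 w)%R].
Proof.
elim: l => [_|p l IH Dl].
  rewrite (_ : [set w | _] = setT); first exact: (@measurableT _ (g_sigma_algebraType _)).
  by apply/seteqP; split.
rewrite (_ : [set w | _] = X p.1 @^-1` `[p.2, +oo[ `&`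
    [set w | forall p, p \in l -> (p.2 <= X p.1 w)%R]).
  apply: sigma_genI; last by apply: IH => q ql; apply: Dl; rewrite in_cons ql orbT.
  by apply: sigma_gen_preimage => //; apply: Dl; rewrite mem_head.
apply/seteqP; split => w /=.
  move=> H; split; first by rewrite in_itv/= andbT; apply: H; rewrite mem_head.
  by move=> q ql; apply: H; rewrite in_cons ql orbT.
by rewrite in_itv/= andbT => -[H1 H2] q; rewrite in_cons => /predU1P[->//|]; exact: H2.
Qed.

Lemma enum_fset_perm (I : choiceType) (s : seq I) :
  uniq s -> perm_eq [fset i in s]%fset s.
Proof.
move=> us; apply: uniq_perm => //.
  by move=> i; rewrite !inE.
Qed.

Lemma set_fset_seq (I : choiceType) (s : seq I) :
  [set` [fset i in s]%fset] = [set` s].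
Proof. by apply/seteqP; split => i; rewrite /= !inE. Qed.

Lemma indep_bigcap (I : choiceType) (F : I -> set (set Om)) (s : seq I)
    (E : I -> set Om) :
  indep P F -> uniq s -> (forall i, i \in s -> F i (E i)) ->
  P (\bigcap_(i in [set` s]) E i) = \prod_(i <- s) P (E i).
Proof.
move=> iF us FE; have := iF [fset i in s]%fset E.
rewrite (perm_big s) ?enum_fset_perm//= => <-; last by move=> i; rewrite !inE; exact: FE.
by rewrite set_fset_seq.
Qed.

Lemma cond_indep_bigcap (G : set (set Om)) (I : choiceType)
    (F : I -> set (set Om)) (s : seq I) (E : I -> set Om)
    (f : I -> Om -> \bar R) :
  cond_indep P G F -> uniq s -> (forall i, i \in s -> F i (E i)) ->
  (forall i, i \in s -> is_cond_prob P G (E i) (f i)) ->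
  is_cond_prob P G (\bigcap_(i in [set` s]) E i)
    (fun w => \prod_(i <- s) f i w).
Proof.
move=> iF us FE Ef; have := iF [fset i in s]%fset E f.
under [X in _ -> _ -> is_cond_prob _ _ _ X]eq_fun do rewrite (perm_big s) ?enum_fset_perm//=.
rewrite set_fset_seq; apply; move=> i; rewrite !inE; [exact: FE|exact: Ef].
Qed.

Lemma emeasurable_prod d' (T : measurableType d') (I : Type) (s : seq I)
    (h : I -> T -> \bar R) :
  (forall i, measurable_fun setT (h i)) ->
  measurable_fun setT (fun x => \prod_(i <- s) h i x).
Proof.
move=> mh; elim: s => [|i s IH].
  by under eq_fun do rewrite big_nil; exact: measurable_cst.
by under eq_fun do rewrite big_cons; exact: emeasurable_funM.
Qed.

Lemma indic_prod (T : Type) (I : eqType) (s : seq I) (A : I -> set T) x :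
  \prod_(i <- s) (\1_(A i) x)%:E =
  (\1_(\bigcap_(i in [set` s]) A i) x)%:E :> \bar R.
Proof.
elim: s => [|i s IH].
  by rewrite big_nil indicE mem_set//= => i.
rewrite big_cons IH -EFinM; congr EFin.
rewrite -[LHS]/((\1_(A i) \* \1_(\bigcap_(i in [set` s]) A i))%R x) -indicI.
congr (\1_ _ x); apply/seteqP; split => [y /= [Ai As] j|y As /=].
  by rewrite /= in_cons => /predU1P[->//|]; exact: As.
split; first by apply: As => /=; rewrite mem_head.
by move=> j /= js; apply: As => /=; rewrite in_cons js orbT.
Qed.

(** For indicators this is the definition of independence. The coordinates are then freed one at a
    time, each by comparing the product of the other factors with the product of their means as
    weights. *)
Lemma indep_integral_prod (K : nat) d' (T : measurableType d')
    (X : 'I_K -> Om -> T) (f : 'I_K -> T -> \bar R) :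
  (forall i, measurable_fun setT (X i)) ->
  (forall i, measurable_fun setT (f i)) -> (forall i x, 0 <= f i x) ->
  indep P (fun i => sigma_gen [set: unit] (fun _ : unit => X i)) ->
  \int[P]_w (\prod_(i < K) f i (X i w)) = \prod_(i < K) \int[P]_w f i (X i w).
Proof.
move=> mX mf f0 iX.
(* Only the coordinates below [j] carry arbitrary functions; those from [j] on are still
   indicators. *)
suff H (j : nat) (g : 'I_K -> T -> \bar R) :
    (forall i, measurable_fun setT (g i)) -> (forall i x, 0 <= g i x) ->
    (forall i : 'I_K, (j <= i)%N ->
      exists2 B, measurable B & g i = fun x => (\1_B x)%:E) ->
    \int[P]_w (\prod_(i < K) g i (X i w)) = \prod_(i < K) \int[P]_w g i (X i w).
  by apply: (H K) => // i; rewrite leqNgt ltn_ord.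
elim: j g => [|j IH] g mg g0 gind.
  have /choice[B HB] : forall i : 'I_K, exists B : set T,
      measurable B /\ g i = fun x => (\1_B x)%:E.
    by move=> i; have [B mB gB] := gind i (leq0n _); exists B.
  have mB i : measurable (B i) by have [] := HB i.
  have mXB i : measurable (X i @^-1` B i) by rewrite -[_ @^-1` _]setTI; exact: mX.
  have gB i w : g i (X i w) = (\1_(X i @^-1` B i) w)%:E.
    by have [_ ->] := HB i; rewrite !indicE.
  under eq_integral do under eq_bigr do rewrite gB.
  under eq_integral do rewrite indic_prod.
  rewrite integral_indic//; last first.
    apply: fin_bigcap_measurable => //; exact: finite_seq.
  rewrite setIT; transitivity (\prod_(i < K) P (X i @^-1` B i)).
    apply: (indep_bigcap iX); first exact: index_enum_uniq.
    by move=> i _; apply: (@sigma_gen_preimage _ _ _ [set: unit] (fun=> X i) tt).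
  by apply: eq_bigr => i _; under eq_integral do rewrite gB; rewrite integral_indic// setIT.
have [jK|Kj] := ltnP j K; last first.
  by apply: IH => // i ji; apply: gind; move: (ltn_ord i); rewrite ltnNge (leq_trans Kj ji).
pose jj := Ordinal jK.
pose u w := \prod_(i < K | i != jj) g i (X i w).
pose c := \prod_(i < K | i != jj) \int[P]_w g i (X i w).
have c0 : 0 <= c by apply: prode_ge0 => i _; exact: integral_ge0.
have mgX i : measurable_fun setT (fun w => g i (X i w)) by exact: measurableT_comp (mX i).
have mu' : measurable_fun setT u.
  have -> : u = fun w => \prod_(i < K) (if i != jj then g i (X i w) else 1).
    by apply/funext => w; rewrite /u big_mkcond.
  by apply: emeasurable_prod => i; case: (i != jj).
have u0 w : 0 <= u w by exact: prode_ge0.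
(* With an indicator placed at [jj], the family [g'] has one free coordinate fewer and falls under
   the induction hypothesis. *)
have E (h : T -> \bar R) : measurable_fun setT h -> (forall x, 0 <= h x) ->
    (exists2 B, measurable B & h = fun x => (\1_B x)%:E) ->
    \int[P]_w (h (X jj w) * u w) = \int[P]_w (h (X jj w) * c).
  move=> mh h0 hB; pose g' i := if i == jj then h else g i.
  have g'j : g' jj = h by rewrite /g' eqxx.
  have g'i i : i != jj -> g' i = g i by rewrite /g' => /negbTE ->.
  transitivity (\int[P]_w (\prod_(i < K) g' i (X i w))).
    apply: eq_integral => w _; rewrite (bigD1 jj)//= g'j; congr (_ * _).
    by apply: eq_bigr => i /g'i ->.
  have -> : \int[P]_w (\prod_(i < K) g' i (X i w)) = (\int[P]_w h (X jj w)) * c.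
    rewrite IH.
    - by rewrite (bigD1 jj)//= g'j; congr (_ * _); apply: eq_bigr => i /g'i ->.
    - by move=> i; rewrite /g'; case: ifP.
    - by move=> i x; rewrite /g'; case: ifP.
    - move=> i ji; rewrite /g'; case: ifPn => [//|ij]; apply: gind.
      by rewrite ltn_neqAle ji andbT eq_sym.
  under [RHS]eq_integral do rewrite muleC.
  rewrite ge0_integralZl// 1?muleC//; exact: measurableT_comp (mX jj).
have := @eq_integral_comp_weight R _ _ Om T P (X jj) u (cst c) (mX jj) mu' u0.
move=> /(_ (measurable_cst _) (fun=> c0)) HH.
rewrite (bigD1 jj)//= -/c; transitivity (\int[P]_w (g jj (X jj w) * u w)).
  by apply: eq_integral => w _; rewrite (bigD1 jj).
rewrite HH//.
  under eq_integral do rewrite muleC.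
  by rewrite ge0_integralZl// muleC.
move=> B mB; apply: (E (fun x => (\1_B x)%:E)) => //.
- exact/measurable_EFinP.
- by exists B.
Qed.

End sigma_gen_indep.

(** * Exponential and logarithm on the extended reals *)

Section exponential_ereal.
Context (R : realType).
Local Open Scope ereal_scope.

Lemma measurable_expeR : measurable_fun setT (@expeR R).
Proof.
apply: (measurability _ (ErealGenCInfty.measurableE R)) => //.
move=> _ [_ [y ->] <-]; rewrite setTI.
have [y0|y0] := ltP 0%R y; last first.
  rewrite (_ : _ @^-1` _ = setT)//; apply/seteqP; split => // x _ /=.
  by rewrite in_itv/= andbT (le_trans _ (expeR_ge0 x))// lee_fin.
rewrite (_ : _ @^-1` _ = setT `&` [set x | (ln y)%:E <= id x]).
  exact: emeasurable_fun_c_infty.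
rewrite setTI; apply/seteqP; split => x /=;
  by rewrite in_itv/= andbT -[in y%:E](@lnK _ y)// -[(expR _)%:E]/(expeR _%:E) lee_expeR.
Qed.

Lemma measurable_lne : measurable_fun setT (@lne R).
Proof.
apply: (measurability _ (ErealGenCInfty.measurableE R)) => //.
move=> _ [_ [y ->] <-]; rewrite setTI.
rewrite (_ : _ @^-1` _ = setT `&` [set x | (expR y)%:E <= id x]).
  exact: emeasurable_fun_c_infty.
rewrite setTI; apply/seteqP; split => x /=; rewrite in_itv/= andbT.
  have [x0|x0] := ltP 0 x; last by rewrite le0_lneNy// leeNy_eq.
  by rewrite -(lee_expeR y%:E) lneK// in_itv/= (ltW x0) leey.
move=> yx; have x0 : 0 <= x by rewrite (le_trans _ yx)// lee_fin expR_ge0.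
by rewrite -lee_expeR lneK// in_itv/= x0 leey.
Qed.

(** Monotonicity alone gives the limit, including [l = +oo]: the infimum of the values is
    nonnegative, hence of the form [expeR z], and [z] is compared with [- l] inside the
    exponential. *)
Lemma cvg_expeRN (u : (\bar R)^nat) (l : \bar R) :
  nondecreasing_seq u -> u n @[n --> \oo] --> l ->
  expeR (- u n) @[n --> \oo] --> expeR (- l).
Proof.
move=> ndu ul.
have ule n : u n <= l.
  have -> : l = ereal_sup (range u).
    rewrite -(cvg_lim _ ul)//; apply: cvg_lim => //.
    exact: ereal_nondecreasing_cvgn.
  by apply: ereal_sup_ubound; exists n.
have -> : expeR (- l) = ereal_inf (range (fun n => expeR (- u n))).
  apply/eqP; rewrite eq_le; apply/andP; split.
    by apply: le_ereal_inf_tmp => _ [n _ <-]; rewrite lee_expeR leeN2.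
  have I0 : 0 <= ereal_inf (range (fun n => expeR (- u n))).
    by apply: le_ereal_inf_tmp => _ [n _ <-]; exact: expeR_ge0.
  have [z zI] := expeR_total I0.
  rewrite -zI lee_expeR leeNr -(cvg_lim _ ul)//; apply: lime_le.
    by apply: cvgP; exact: ul.
  apply: nearW => n; rewrite leeNr -lee_expeR zI.
  by apply: ereal_inf_lbound; exists n.
apply: ereal_nonincreasing_cvgn => m n mn.
by rewrite lee_expeR leeN2; exact: ndu.
Qed.

Lemma expeRN_sum (I : Type) (s : seq I) (f : I -> \bar R) :
  (forall i, 0 <= f i) ->
  expeR (- \sum_(i <- s) f i) = \prod_(i <- s) expeR (- f i).
Proof.
move=> f0; elim: s => [|i s IH]; first by rewrite !big_nil oppe0 expeR0.
rewrite !big_cons oppeD ?expeRD ?IH// ge0_adde_def ?inE//.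
exact: sume_ge0.
Qed.

Lemma expR_eseries (x : R) : (0 <= x)%R ->
  \sum_(0 <= k <oo) (x ^+ k / k`!%:R)%:E = (expR x)%:E.
Proof.
move=> x0; rewrite expRE -EFin_lim; last first.
  rewrite /pseries/=; under eq_fun do rewrite mulrC.
  exact: is_cvg_series_exp_coeff.
apply/congr_lim/funext => n/=; rewrite /pseries/= /series/= -sumEFin//.
by under eq_bigr do rewrite mulrC.
Qed.

End exponential_ereal.

(** * Laplace transform of a Poisson variable *)

Section poisson_laplace.
Context (R : realType) (d : measure_display) (Om : measurableType d)
  (P : probability Om R).
Local Open Scope ereal_scope.

(** [N] may take values other than natural numbers, but only on a null set, because the Poisson
    weights already sum to 1. Elsewhere the integral is the exponential series at
    [lambda * expR (- a)]. *)
Lemma poisson_laplace (N : Om -> \bar R) (lambda a : R) :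
  measurable_fun setT N -> (0 <= lambda)%R ->
  (forall k : nat, P [set w | N w = k%:R%:E] =
    (lambda ^+ k / k`!%:R * expR (- lambda))%:E) ->
  \int[P]_w expeR (- (a%:E * N w)) = (expR (- ((1 - expR (- a)) * lambda)))%:E.
Proof.
move=> mN l0 PN.
pose D k := [set w | N w = k%:R%:E].
have mD k : measurable (D k).
  rewrite (_ : D k = setT `&` N @^-1` [set k%:R%:E]); last by rewrite setTI.
  by apply: mN => //; exact: emeasurable_set1.
have tD : trivIset setT D.
  apply/trivIsetP => i j _ _ ij; apply/seteqP; split => // w; rewrite /D/= => -[-> []].
  by move=> /eqP; rewrite eqr_nat (negbTE ij).
have PD : P (\bigcup_k D k) = 1.
  rewrite measure_bigcup//=.
  transitivity (\sum_(0 <= k <oo) P (D k)).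
    by apply: eq_eseriesl => k; rewrite in_setT.
  transitivity (\sum_(0 <= k <oo)
      ((expR (- lambda))%:E * (lambda ^+ k / k`!%:R)%:E)).
    by apply: eq_eseriesr => k _; rewrite [LHS]PN -EFinM mulrC.
  rewrite nneseriesZl; last by move=> k _; rewrite lee_fin divr_ge0// exprn_ge0.
  by rewrite expR_eseries// -EFinM -expRD addNr expR0.
have mUD : measurable (\bigcup_k D k) by exact: bigcup_measurable.
have PC : P (~` \bigcup_k D k) = 0 by rewrite probability_setC// PD subee.
have mf : measurable_fun setT (fun w => expeR (- (a%:E * N w))).
  apply: measurableT_comp; first exact: measurable_expeR.
  apply: measurableT_comp => //; exact: measurable_funeM.
rewrite (@ge0_negligible_integral _ _ _ P setT (~` \bigcup_k D k))//; first last.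
- by move=> w _; exact: expeR_ge0.
- exact: measurableC.
rewrite setTD setCK ge0_integral_bigcup//; first last.
- by move=> w _; exact: expeR_ge0.
- exact: measurable_funTS.
transitivity (\sum_(0 <= k <oo) ((expR (- lambda))%:E *
    ((lambda * expR (- a)) ^+ k / k`!%:R)%:E)).
  apply: eq_eseriesr => k _.
  rewrite (eq_integral (cst (expR (- (a * k%:R)))%:E)); last first.
    by move=> w; rewrite inE /D/= => ->.
  transitivity ((expR (- (a * k%:R)))%:E * P (D k)); first exact: integral_cst.
  rewrite (PN k) -!EFinM; congr EFin.
  rewrite exprMn -mulNr expRM_natr; ring.
rewrite nneseriesZl; last first.
  by move=> k _; rewrite lee_fin divr_ge0// exprn_ge0// mulr_ge0// expR_ge0.
rewrite expR_eseries ?mulr_ge0 ?expR_ge0// -EFinM -expRD; congr (expR _)%:E; ring.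
Qed.

End poisson_laplace.

(** * Laplace functional of the Poisson points *)

Section poisson_functional.
Context (R : realType).
Local Open Scope ereal_scope.
Notation mu := (@lebesgue_measure R).

Definition eta_integral (f : R -> \bar R) : \bar R :=
  \int[mu]_(w in `[0%R, +oo[) (((3 / 2) * w `^ (1 / 2))%:E * f w).

Lemma eta_density_ge0 (w : R) : (0 <= (3 / 2) * w `^ (1 / 2))%R.
Proof. by rewrite mulr_ge0 ?powR_ge0. Qed.

Lemma measurable_eta_density (D : set R) :
  measurable_fun D (fun w => ((3 / 2) * w `^ (1 / 2))%:E : \bar R).
Proof.
apply/measurable_EFinP; exact: measurable_funTS (measurable_funM _ _).
Qed.

Lemma measurable_eta_integrand (D : set R) (f : R -> \bar R) :
  measurable_fun setT f ->
  measurable_fun D (fun w => ((3 / 2) * w `^ (1 / 2))%:E * f w).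
Proof.
move=> mf; apply: emeasurable_funM; first exact: measurable_eta_density.
exact: measurable_funTS.
Qed.

Lemma eta_intensityE (A : set R) :
  eta_intensity A = eta_integral (fun x => (\1_A x)%:E).
Proof.
rewrite /eta_intensity /eta_integral setIC integral_mkcondr.
apply: eq_integral => x _; rewrite /patch indicE; case: ifPn => xA.
  by rewrite mule1.
by rewrite mule0.
Qed.

Lemma eta_intensity_ge0 (A : set R) : 0 <= eta_intensity A.
Proof. by apply: integral_ge0 => x _; rewrite lee_fin eta_density_ge0. Qed.

(** The density increases on the half-line, so on [A] it is at most its value at [k]. This provides
    the finite intensity under which the counts have Poisson weights. *)
Lemma eta_intensity_bounded (k : R) (A : set R) : measurable A ->
  A `<=` `[(- k)%R, k] -> eta_intensity A < +oo.
Proof.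
move=> mA Ak; rewrite /eta_intensity.
have [k0|k0] := ltP k 0%R.
  rewrite (_ : A = set0) ?set0I ?integral_set0//.
  rewrite -subset0 => x /Ak/=; rewrite in_itv/= => /andP[kx xk].
  have : (- k <= k)%R by exact: le_trans kx xk.
  by move=> ?; move: k0; rewrite ltNge; apply/negP; rewrite negbK; lra.
have mAI : measurable (A `&` `[0%R, +oo[) by exact: measurableI.
apply: (@le_lt_trans _ _ (\int[mu]_(w in A `&` `[0%R, +oo[)
    cst ((3 / 2) * k `^ (1 / 2))%:E w)).
  apply: ge0_le_integral => //.
  - by move=> x _; rewrite lee_fin eta_density_ge0.
  - exact: measurable_eta_density.
  - move=> x [/Ak/=]; rewrite !in_itv/= andbT => /andP[_ xk] x0.
    rewrite lee_fin ler_wpM2l// ge0_ler_powR ?nnegrE//.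
rewrite integral_cst//= lte_mul_pinfty ?lee_fin ?eta_density_ge0//.
apply: (@le_lt_trans _ _ (mu `[(- k)%R, k])).
  by apply: le_measure; rewrite ?inE//; exact: subset_trans (@subIsetl _ _ _) Ak.
by rewrite /= lebesgue_measure_itv/=; case: ifPn => // _; rewrite -EFinB ltry.
Qed.

Lemma eta_integral_sum (K : nat) (c : 'I_K -> R) (A : 'I_K -> set R) :
  (forall i, 0 <= c i)%R -> (forall i, measurable (A i)) ->
  eta_integral (fun x => \sum_(i < K) (c i)%:E * (\1_(A i) x)%:E) =
  \sum_(i < K) (c i)%:E * eta_intensity (A i).
Proof.
move=> c0 mA; rewrite /eta_integral.
have mind i : measurable_fun setT (fun x => (\1_(A i) x)%:E : \bar R).
  exact/measurable_EFinP.
transitivity (\int[mu]_(w in `[0%R, +oo[) \sum_(i < K)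
    ((c i)%:E * (((3 / 2) * w `^ (1 / 2))%:E * (\1_(A i) w)%:E))).
  apply: eq_integral => x _; rewrite ge0_sume_distrr; last first.
    by move=> i _; rewrite mule_ge0// lee_fin.
  by apply: eq_bigr => i _; rewrite muleCA.
rewrite ge0_integral_sum//.
- apply: eq_bigr => i _; rewrite ge0_integralZl_EFin ?eta_intensityE//.
  + by move=> x _; rewrite mule_ge0// lee_fin ?eta_density_ge0.
  + exact: measurable_eta_integrand.
- by move=> i; apply: measurable_funeM; exact: measurable_eta_integrand.
- by move=> i x _; rewrite !mule_ge0// lee_fin ?eta_density_ge0.
Qed.

Context (d : measure_display) (Om : measurableType d) (P : probability Om R)
  (W : nat -> Om -> R) (hW : poisson_points P (@eta_intensity R) W).

Let mW n : measurable_fun setT (W n). Proof. by case: hW => -[]. Qed.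

Lemma measurable_count_points (A : set R) : measurable A ->
  measurable_fun setT (count_points W A).
Proof.
move=> mA; rewrite (_ : count_points W A =
    fun w => \sum_(0 <= i <oo | i \in xpredT) (\1_A (W i w))%:E); last first.
  by apply/funext => w; apply: eq_eseriesl.
apply: ge0_emeasurable_sum; first by move=> k x _ _; rewrite lee_fin.
move=> k _; apply/measurable_EFinP.
have mI : measurable_fun setT (\1_A : R -> R) by [].
exact: measurableT_comp mI (mW k).
Qed.

(** Summed over the points, [f] becomes a linear combination of the counts in the disjoint sets
    [A i]. These are independent Poisson variables, so the expectation factors. *)
Lemma poisson_laplace_simple (K : nat) (a : 'I_K -> R) (A : 'I_K -> set R) :
  (forall i, 0 <= a i)%R -> (forall i, measurable (A i)) ->
  trivIset setT A -> (forall i, eta_intensity (A i) < +oo) ->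
  let f x := \sum_(i < K) (a i)%:E * (\1_(A i) x)%:E in
  \int[P]_w expeR (- \sum_(0 <= n <oo) f (W n w)) =
  expeR (- eta_integral (fun x => 1 - expeR (- f x))).
Proof.
move=> a0 mA tA fA f.
pose N i := count_points W (A i).
have N0 i w : 0 <= N i w by apply: nneseries_ge0 => n _ _; rewrite lee_fin.
have mN i : measurable_fun setT (N i) by exact: measurable_count_points.
have fN w : \sum_(0 <= n <oo) f (W n w) = \sum_(i < K) (a i)%:E * N i w.
  rewrite /f nneseries_sum; last by move=> i j _; rewrite mule_ge0// lee_fin.
  by apply: eq_bigr => i _; rewrite nneseriesZl// => n _; rewrite lee_fin.
have fE w : expeR (- \sum_(0 <= n <oo) f (W n w)) =
    \prod_(i < K) expeR (- ((a i)%:E * N i w)).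
  by rewrite fN expeRN_sum// => i; rewrite mule_ge0// lee_fin.
under eq_integral do rewrite fE.
rewrite (@indep_integral_prod _ _ _ P K _ _ N
  (fun i x => expeR (- ((a i)%:E * x)))) //; last 3 first.
- move=> i; apply: measurableT_comp; first exact: measurable_expeR.
  by apply: measurableT_comp => //; exact: measurable_funeM.
- by move=> i x; exact: expeR_ge0.
- by case: hW => _ _ _; exact.
pose c i := (1 - expR (- a i))%R.
have c0 i : (0 <= c i)%R by rewrite subr_ge0 expR_le1 oppr_le0.
(* As the [A i] are disjoint, [1 - expeR (- f x)] equals [c i] on [A i] and 0 off their union: it is
   again a combination of the same indicators. *)
have -> : eta_integral (fun x => 1 - expeR (- f x)) =
    \sum_(i < K) (c i)%:E * eta_intensity (A i).
  rewrite -eta_integral_sum//; congr eta_integral; apply/funext => x.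
  have [[i Aix]|nA] := pselect (exists i, A i x).
    have nAj j : j != i -> (\1_(A j) x)%:E = 0 :> \bar R.
      move=> ji; rewrite indicE memNset// => Ajx.
      by move/trivIsetP : tA => /(_ j i Logic.I Logic.I ji)/seteqP[/(_ x (conj Ajx Aix))].
    have E (b : 'I_K -> R) : \sum_(j < K) (b j)%:E * (\1_(A j) x)%:E = (b i)%:E.
      rewrite (bigD1 i)//= big1 ?adde0 ?indicE ?mem_set ?mule1// => j ji.
      by rewrite nAj// mule0.
    by rewrite /f !E.
  have E (b : 'I_K -> R) : \sum_(j < K) (b j)%:E * (\1_(A j) x)%:E = 0.
    apply: big1 => j _; rewrite indicE memNset ?mule0// => Ajx.
    by apply: nA; exists j.
  by rewrite /f !E oppe0 expeR0 subee.
rewrite expeRN_sum; last first.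
  by move=> i; rewrite mule_ge0 ?lee_fin// eta_intensity_ge0.
apply: eq_bigr => i _.
rewrite (@poisson_laplace _ _ _ P (N i) (fine (eta_intensity (A i))) (a i)) //.
- rewrite -[RHS]/(expeR _) -[in RHS](fineK (x := eta_intensity (A i))) //.
  by rewrite ge0_fin_numE// eta_intensity_ge0.
- by rewrite fine_ge0// eta_intensity_ge0.
- by case: hW => _ H _ _ k; exact: H.
Qed.

Import HBNNSimple.

(** The value [+oo] is allowed for [f], as it will be the opposite of a logarithm of a probability.
    The simple case is passed to the limit on both sides. *)
Lemma poisson_laplace_functional (f : R -> \bar R) :
  measurable_fun setT f -> (forall x, 0 <= f x) ->
  \int[P]_w expeR (- \sum_(0 <= n <oo) f (W n w)) =
  expeR (- eta_integral (fun x => 1 - expeR (- f x))).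
Proof.
move=> mf f0.
pose g := nnsfun_approx measurableT mf.
(* Cutting at [k] keeps the level sets bounded, hence of finite intensity; at a given [x] the cut is
   inactive once [k] exceeds the absolute value of [x]. *)
pose h k x := ((g k x) * \1_(`[(- k%:R)%R, k%:R]) x)%R.
have h0 k x : (0 <= h k x)%R by rewrite mulr_ge0.
have mh k : measurable_fun setT (fun x => (h k x)%:E).
  by apply/measurable_EFinP; exact: measurable_funM.
have ndh x : nondecreasing_seq (fun k => (h k x)%:E).
  move=> m n mn; rewrite lee_fin ler_pM//; first exact/lefP/nd_nnsfun_approx.
  rewrite !indicE ler_nat; case: (boolP (x \in `[(- m%:R)%R, m%:R]%classic)) => //.
  rewrite inE/= in_itv/= => /andP[mx xm]; rewrite mem_set//= in_itv/=.
  have mnR : (m%:R <= n%:R :> R)%R by rewrite ler_nat.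
  by rewrite (le_trans _ mx) ?lerN2// (le_trans xm).
have hf x : (h k x)%:E @[k --> \oo] --> f x.
  have gf : (g k x)%:E @[k --> \oo] --> f x by exact: cvg_nnsfun_approx.
  apply: cvg_trans gf; apply: near_eq_cvg.
  exists (Num.truncn `|x|).+1 => // k /= xk; rewrite /h indicE mem_set ?mulr1//=.
  rewrite in_itv/= -ler_norml ltW// (lt_le_trans (truncnS_gt _))//.
  by rewrite ler_nat.
have simple k : \int[P]_w expeR (- \sum_(0 <= n <oo) (h k (W n w))%:E) =
    expeR (- eta_integral (fun x => 1 - expeR (- (h k x)%:E))).
  pose s : seq R := fset_set (range (g k)).
  pose A (i : 'I_(size s)) := g k @^-1` [set s`_i] `&` `[(- k%:R)%R, k%:R].
  have hE x : (h k x)%:E = \sum_(i < size s) (s`_i)%:E * (\1_(A i) x)%:E.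
    rewrite /h fimfunEord mulr_suml -sumEFin; apply: eq_bigr => i _.
    by rewrite -EFinM -mulrA /A indicI.
  rewrite (_ : (fun x => (1 - expeR (- (h k x)%:E))) =
      (fun x => (1 - expeR (- \sum_(i < size s) (s`_i)%:E * (\1_(A i) x)%:E)))).
    rewrite -poisson_laplace_simple.
    - apply: eq_integral => w _; congr (expeR (- _)); apply: eq_eseriesr => n _.
      exact: hE.
    - move=> i; have : s`_i \in s by exact: mem_nth.
      by rewrite in_fset_set// inE => -[x _ <-].
    - by move=> i; exact: measurableI.
    - apply/trivIsetP => i j _ _ ij; apply/seteqP; split => // x [[/= gi _] [/= gj _]].
      have /eqP : s`_i = s`_j by rewrite -gi -gj.
      by rewrite nth_uniq// ?fset_uniq// (inj_eq val_inj) (negbTE ij).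
    - by move=> i; apply: (@eta_intensity_bounded k%:R); [exact: measurableI|exact: subIsetr].
  by apply/funext => x; rewrite hE.
have mhW k n : measurable_fun setT (fun w => (h k (W n w))%:E).
  exact: measurableT_comp (mh k) (mW n).
have mfW n : measurable_fun setT (fun w => f (W n w)).
  exact: measurableT_comp mf (mW n).
have mser (u : nat -> Om -> \bar R) : (forall n, measurable_fun setT (u n)) ->
    (forall n w, 0 <= u n w) ->
    measurable_fun setT (fun w => expeR (- \sum_(0 <= n <oo) u n w)).
  move=> mu' u0; apply: measurableT_comp; first exact: measurable_expeR.
  apply: measurableT_comp => //.
  rewrite (_ : (fun w => _) = fun w => \sum_(0 <= n <oo | n \in xpredT) u n w).
    exact: ge0_emeasurable_sum.
  by apply/funext => w; apply: eq_eseriesl.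
have serh w : \sum_(0 <= n <oo) (h k (W n w))%:E @[k --> \oo] -->
    \sum_(0 <= n <oo) f (W n w).
  (* Monotone convergence for the counting measure exchanges the series with the limit in [k]. *)
  rewrite -ge0_integral_count//.
  rewrite (_ : (fun k => _) = fun k => \int[counting]_n (h k (W n w))%:E); last first.
    by apply/funext => k; rewrite ge0_integral_count// => n; rewrite lee_fin.
  rewrite (_ : (fun t => f (W t w)) = fun n => limn (fun k => (h k (W n w))%:E)).
    apply: (@cvg_monotone_convergence _ nat R counting setT measurableT
      (fun k n => (h k (W n w))%:E)) => //.
    by move=> j n _; rewrite lee_fin.
  by apply/funext => n; apply/esym/cvg_lim => //; exact: hf.
have ndser w : nondecreasing_seq (fun k => \sum_(0 <= n <oo) (h k (W n w))%:E).
  move=> m n mn; apply: lee_nneseries.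
    by move=> k _ _; rewrite lee_fin.
  by move=> k _; exact: (ndh _ _ _ mn).
(* These integrands decrease in [k], so the limit is taken by domination by 1, whereas the exponents
   increase and allow monotone convergence. *)
have cvgL : \int[P]_w expeR (- \sum_(0 <= n <oo) (h k (W n w))%:E) @[k --> \oo]
    --> \int[P]_w expeR (- \sum_(0 <= n <oo) f (W n w)).
  apply: (@dominated_cvg _ Om R P setT measurableT
    (fun k w => expeR (- \sum_(0 <= n <oo) (h k (W n w))%:E)) _ (cst 1)) => //.
  - by move=> k; apply: mser => [//|n w]; rewrite lee_fin.
  - by move=> w _; apply: cvg_expeRN.
  - exact: finite_measure_integrable_cst.
  - move=> k w _; rewrite gee0_abs ?expeR_ge0// -expeR0 lee_expeR.
    by rewrite leeNl oppe0 nneseries_ge0// => n _ _; rewrite lee_fin.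
have mE (u : R -> \bar R) : measurable_fun setT u ->
    measurable_fun setT (fun x => 1 - expeR (- u x)).
  move=> mu'; apply: emeasurable_funB => //.
  apply: measurableT_comp; first exact: measurable_expeR.
  exact: measurableT_comp.
have E0 (u : \bar R) : 0 <= u -> 0 <= 1 - expeR (- u).
  move=> u0; have : expeR (- u) <= 1 by rewrite -expeR0 lee_expeR leeNl oppe0.
  by rewrite sube_ge0 ?orbT.
have ndE x : nondecreasing_seq (fun k => 1 - expeR (- (h k x)%:E)).
  by move=> m n mn; rewrite leeB// lee_expeR leeN2; exact: (ndh _ _ _ mn).
have cE x : 1 - expeR (- (h k x)%:E) @[k --> \oo] --> 1 - expeR (- f x).
  apply: cvgeB => //; first exact: cvg_cst.
  exact: cvg_expeRN.
have cvgI : eta_integral (fun x => 1 - expeR (- (h k x)%:E)) @[k --> \oo] -->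
    eta_integral (fun x => 1 - expeR (- f x)).
  rewrite /eta_integral.
  rewrite [X in _ --> X](_ : _ = \int[mu]_(x in `[0%R, +oo[) limn (fun k =>
    ((3 / 2) * x `^ (1 / 2))%:E * (1 - expeR (- (h k x)%:E)))).
    apply: cvg_monotone_convergence => //.
    - by move=> k; apply: measurable_eta_integrand; exact: mE.
    - move=> k x _; apply: mule_ge0; first by rewrite lee_fin eta_density_ge0.
      by apply: E0; rewrite lee_fin.
    - move=> x _ m n mn; rewrite lee_wpmul2l ?lee_fin ?eta_density_ge0//.
      exact: (ndE _ _ _ mn).
  by apply: eq_integral => x _; apply/esym/cvg_lim => //; exact: cvgeZl.
have ndI : nondecreasing_seq (fun k =>
    eta_integral (fun x => 1 - expeR (- (h k x)%:E))).
  move=> m n mn; apply: ge0_le_integral => //.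
  - move=> x _; apply: mule_ge0; first by rewrite lee_fin eta_density_ge0.
    by apply: E0; rewrite lee_fin.
  - by apply: measurable_eta_integrand; exact: mE.
  - by apply: measurable_eta_integrand; exact: mE.
  - move=> x _; rewrite lee_wpmul2l ?lee_fin ?eta_density_ge0//.
    exact: (ndE _ _ _ mn).
rewrite -(cvg_lim _ cvgL)// -(cvg_lim _ (cvg_expeRN ndI cvgI))//.
by under eq_fun do rewrite simple.
Qed.

End poisson_functional.

(** * Transition operator and path probabilities of a one-sided process *)

Section tangent_operator.
Context (R : realType).
Local Open Scope ereal_scope.
Notation mu := (@lebesgue_measure R).

(* The absolute value only matters for [x < 0], where the density may be
   negative and which a tangent process never visits. *)
Definition tangent_op (s t : R) (f : R -> \bar R) (x : R) : \bar R :=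
  \int[mu]_(y in `]0%R, +oo[) (`|tangent_density s t x y|%:E * f y).

Lemma tangent_density_ge0 (s t x y : R) :
  (s < t -> 0 <= x -> 0 < y -> 0 <= tangent_density s t x y)%R.
Proof.
move=> st x0 y0; rewrite /tangent_density divr_ge0//.
  apply: mulr_ge0; last exact: sqrtr_ge0.
  by apply: mulr_ge0 => //; rewrite subr_ge0 ltW.
apply: mulr_ge0; first exact: pi_ge0.
apply: addr_ge0; last by apply: exprn_ge0; rewrite subr_ge0 ltW.
apply: addr_ge0; first exact: sqr_ge0.
apply: mulr_ge0; last exact: sqr_ge0.
by apply: mulr_ge0 => //; rewrite addr_ge0// ltW.
Qed.

Lemma measurable_tangent_density2 (s t : R) :
  measurable_fun setT (fun z : R * R => `|tangent_density s t z.1 z.2|%R).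
Proof.
(* The inverse is written as the power [- 1] of a nonnegative number, which is a measurable function
   even where the denominator vanishes. *)
rewrite (_ : (fun z => _) = fun z : R * R =>
  (`|2 * (t - s)| * `|Num.sqrt z.2| *
  `|pi * ((z.2 - z.1) ^+ 2 + 2 * (z.1 + z.2) * (t - s) ^+ 2 + (t - s) ^+ 4)|
    `^ (- 1))%R); last first.
  by apply/funext => z; rewrite /tangent_density normf_div powR_inv1// -normrM.
have m1 : measurable_fun setT (fun z : R * R => z.1) by exact: measurable_fst.
have m2 : measurable_fun setT (fun z : R * R => z.2) by exact: measurable_snd.
apply: measurable_funM.
  apply: measurable_funM => //; apply: measurableT_comp => //.
  apply: measurableT_comp m2; apply: continuous_measurable_fun.
  exact: sqrt_continuous.
apply: (measurableT_comp (measurable_powR (-1)%R)).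
apply: measurableT_comp => //; apply: measurable_funM => //.
apply: measurable_funD => //; apply: measurable_funD.
  by apply: measurable_funX; exact: measurable_funB.
by apply: measurable_funM => //; apply: measurable_funM => //; exact: measurable_funD.
Qed.

Lemma measurable_tangent_density (s t x : R) (D : set R) :
  measurable_fun D (fun y : R => `|tangent_density s t x y|%:E).
Proof.
apply/measurable_EFinP; apply: measurable_funTS.
exact: (measurableT_comp (measurable_tangent_density2 s t) (measurable_pair1 x)).
Qed.

Lemma measurable_tangent_integrand (s t x : R) (D : set R) (f : R -> \bar R) :
  measurable_fun setT f ->
  measurable_fun D (fun y : R => `|tangent_density s t x y|%:E * f y).
Proof.
move=> mf; apply: emeasurable_funM; first exact: measurable_tangent_density.
exact: measurable_funTS.
Qed.

Lemma tangent_op_ge0 (s t : R) (f : R -> \bar R) x :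
  (forall y, 0 <= f y) -> 0 <= tangent_op s t f x.
Proof. by move=> f0; apply: integral_ge0 => y _; rewrite mule_ge0. Qed.

Lemma measurable_tangent_op (s t : R) (f : R -> \bar R) :
  measurable_fun setT f -> (forall y, 0 <= f y) ->
  measurable_fun setT (tangent_op s t f).
Proof.
move=> mf f0.
(* Tonelli's theorem is applied on the whole product, so the restriction to the half-line goes into
   the integrand as an indicator. *)
pose h (z : R * R) := `|tangent_density s t z.1 z.2|%:E *
  (f z.2 * (\1_(`]0%R, +oo[) z.2)%:E).
have -> : tangent_op s t f = fubini_F mu h.
  apply/funext => x; rewrite /tangent_op [LHS]integral_mkcond.
  apply: eq_integral => y _; rewrite /h /= /patch indicE.
  by case: ifPn => yD; rewrite ?mule1// !mule0.
have m2 : measurable_fun setT (fun z : R * R => z.2) by exact: measurable_snd.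
apply: measurable_fun_fubini_tonelli_F.
  apply: emeasurable_funM.
    by apply/measurable_EFinP; exact: measurable_tangent_density2.
  apply: emeasurable_funM; first exact: measurableT_comp m2.
  apply/measurable_EFinP.
  have mI : measurable_fun setT (\1_(`]0%R, +oo[%classic) : R -> R) by [].
  exact: measurableT_comp mI m2.
by move=> z; rewrite /h !mule_ge0// lee_fin.
Qed.

Lemma tangent_transE (s t x : R) (B : set R) : (s < t)%R -> (0 <= x)%R ->
  tangent_trans s t x B = tangent_op s t (fun y => (\1_B y)%:E) x.
Proof.
move=> st x0; rewrite /tangent_trans /tangent_op setIC integral_mkcondr.
apply: eq_integral => y; rewrite inE/= in_itv/= andbT => y0.
rewrite /patch indicE; case: ifPn => yB; rewrite ?mule0// mule1.
by rewrite ger0_norm// tangent_density_ge0.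
Qed.

(* The constraint [(t, b)] of a list reads "value at least [b] at time [t]". *)
Fixpoint path_prob (s : R) (l : seq (R * R)) (x : R) : \bar R :=
  if l is (t, b) :: l' then
    let f y := (\1_(`[b, +oo[) y)%:E * path_prob t l' y in
    if t == s then f x else tangent_op s t f x
  else 1.

Lemma path_prob_ge0 s l x : 0 <= path_prob s l x.
Proof.
elim: l s x => [//|[t b] l IH] s x /=.
case: ifP => _; first by rewrite mule_ge0// lee_fin.
by apply: tangent_op_ge0 => y; rewrite mule_ge0// lee_fin.
Qed.

Lemma measurable_path_prob s l : measurable_fun setT (path_prob s l).
Proof.
elim: l s => [|[t b] l IH] s /=; first exact: measurable_cst.
have mf : measurable_fun setT
    (fun y => (\1_(`[b, +oo[%classic : set R) y)%:E * path_prob t l y).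
  by apply: emeasurable_funM => //; exact/measurable_EFinP.
case: (t == s) => //; apply: measurable_tangent_op => // y.
by rewrite mule_ge0 ?path_prob_ge0// lee_fin.
Qed.

Context (d : measure_display) (Om : measurableType d) (P : probability Om R).
Variables (G : set (set Om)) (x0 : Om -> R) (X : R -> Om -> R).
Hypotheses (Gm : G `<=` measurable) (hX : tangent_one_sided P G x0 X).

Let past s := <<s G `|` sigma_gen `[0%R, s] X >>.

Let mX t : (0 <= t)%R -> measurable_fun setT (X t).
Proof. by case: hX => H _ _ _ t0; exact: H. Qed.

Let past_measurable s : past s `<=` measurable.
Proof.
apply: smallest_sub; first exact: sigma_algebra_measurable.
move=> A [/Gm//|]; apply: sigma_gen_measurable => t /=.
by rewrite in_itv/= => /andP[t0 _]; exact: mX.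
Qed.

Let past_mono s t : (s <= t)%R -> past s `<=` past t.
Proof.
move=> st; apply: smallest_sub; first exact: smallest_sigma_algebra.
move=> A [GA|]; first by apply: sub_sigma_algebra; left.
move=> H; apply: sub_sigma_algebra; right; move: A H.
apply: smallest_sub; first exact: smallest_sigma_algebra.
move=> _ [i [B [/= si mB ->]]]; apply: sub_sigma_algebra; exists i, B; split => //=.
by move: si; rewrite !in_itv/= => /andP[-> /le_trans]; apply.
Qed.

(** The Markov property is assumed for indicators of [X t]; both sides are additive, homogeneous and
    continuous along increasing sequences in [f]. *)
Lemma tangent_op_markov (s t : R) (A : set Om) (f : R -> \bar R) :
  (0 <= s)%R -> (s < t)%R -> past s A ->
  measurable_fun setT f -> (forall y, 0 <= f y) ->
  \int[P]_(w in A) f (X t w) = \int[P]_(w in A) tangent_op s t f (X s w).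
Proof.
move=> s0 st pA.
have mA : measurable A by exact: past_measurable pA.
have t0 : (0 <= t)%R by exact: ltW (le_lt_trans s0 st).
have mfX (g : R -> \bar R) : measurable_fun setT g ->
    measurable_fun A (fun w => g (X t w)).
  by move=> mg; apply: measurable_funTS; exact: measurableT_comp mg (mX t0).
have mgX (g : R -> \bar R) : measurable_fun setT g ->
    measurable_fun A (fun w => g (X s w)).
  by move=> mg; apply: measurable_funTS; exact: measurableT_comp mg (mX s0).
move: f; apply: ge0_measurable_ind.
- move=> B mB; have mXB : measurable (X t @^-1` B).
    by rewrite -[_ @^-1` _]setTI; exact: mX.
  have [_ X0 _ markov] := hX.
  have [_ _ /(_ A pA) H] := markov s t B s0 st mB.
  transitivity (P (A `&` X t @^-1` B)).
    by rewrite setIC -integral_indic.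
  rewrite -H; apply: eq_integral => w _; rewrite tangent_transE//.
  exact: X0.
- move=> f g mf f0 mg g0 IHf IHg.
  rewrite (ge0_integralD _ mA (fun w _ => f0 (X t w)) (mfX _ mf)
    (fun w _ => g0 (X t w)) (mfX _ mg)).
  rewrite IHf IHg -(ge0_integralD _ mA (fun w _ => tangent_op_ge0 s t (X s w) f0)
    (mgX _ (measurable_tangent_op s t mf f0))
    (fun w _ => tangent_op_ge0 s t (X s w) g0)
    (mgX _ (measurable_tangent_op s t mg g0))).
  + apply: eq_integral => w _; rewrite /tangent_op -ge0_integralD//.
    * by apply: eq_integral => y _; rewrite ge0_muleDr.
    * by move=> y _; rewrite mule_ge0.
    * exact: measurable_tangent_integrand.
    * by move=> y _; rewrite mule_ge0.
    * exact: measurable_tangent_integrand.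
- move=> k f k0 mf f0 IH.
  rewrite (ge0_integralZl_EFin _ mA (fun w _ => f0 (X t w)) (mfX _ mf) k0).
  rewrite IH -(ge0_integralZl_EFin _ mA
    (fun w _ => tangent_op_ge0 s t (X s w) f0)
    (mgX _ (measurable_tangent_op s t mf f0)) k0).
  + apply: eq_integral => w _; rewrite /tangent_op -ge0_integralZl_EFin//.
    * by apply: eq_integral => y _; rewrite muleCA.
    * by move=> y _; rewrite mule_ge0.
    * exact: measurable_tangent_integrand.
- move=> f mf f0 ndf IH.
  have op_lim x : tangent_op s t (fun y => limn (f ^~ y)) x =
      limn (fun n => tangent_op s t (f n) x).
    rewrite /tangent_op -monotone_convergence//.
    + apply: eq_integral => y _; apply/esym/cvg_lim => //.
      by apply: cvgeZl => //; exact: ereal_nondecreasing_is_cvgn.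
    + by move=> n; exact: measurable_tangent_integrand.
    + by move=> n y _; rewrite mule_ge0.
    + by move=> y _ m n mn; rewrite lee_wpmul2l// (ndf y _ _ mn).
  transitivity (limn (fun n => \int[P]_(w in A) f n (X t w))).
    rewrite monotone_convergence// => n; exact: mfX.
  under eq_fun do rewrite IH.
  rewrite -monotone_convergence//.
  + by apply: eq_integral => w _; rewrite op_lim.
  + by move=> n; apply: mgX; exact: measurable_tangent_op.
  + by move=> n w _; exact: tangent_op_ge0.
  + move=> w _ m n mn; apply: ge0_le_integral => //.
    * by move=> y _; rewrite mule_ge0.
    * exact: measurable_tangent_integrand.
    * exact: measurable_tangent_integrand.
    * by move=> y _; rewrite lee_wpmul2l// (ndf y _ _ mn).
Qed.

(** The first constraint is absorbed into the event: [A] from the past of [s] becomes an event of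
    the past of [t], to which the induction hypothesis applies. The Markov property then brings the
    integrand back from [t] to [s]. *)
Lemma tangent_path_prob (s : R) (l : seq (R * R)) (A : set Om) :
  (0 <= s)%R -> path <=%R s (map fst l) -> past s A ->
  P (A `&` [set w | forall p, p \in l -> p.2 <= X p.1 w]%R) =
  \int[P]_(w in A) path_prob s l (X s w).
Proof.
elim: l s A => [|[t b] l IH] s A s0 /=.
  move=> _ pA; rewrite (_ : [set w | _] = setT); last by apply/seteqP; split.
  by rewrite setIT integral_cst ?mul1e//; exact: past_measurable pA.
move=> /andP[st tl] pA.
have t0 : (0 <= t)%R by exact: le_trans st.
have mA : measurable A by exact: past_measurable pA.
have pXb : past t (X t @^-1` `[b, +oo[).
  apply: sub_sigma_algebra; right; apply: sigma_gen_preimage => //=.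
  by rewrite in_itv/= t0 lexx.
have pAX : past t (A `&` X t @^-1` `[b, +oo[).
  apply: sigma_genI => //; exact: past_mono pA.
have -> : A `&` [set w | forall p, p \in (t, b) :: l -> p.2 <= X p.1 w]%R =
    A `&` X t @^-1` `[b, +oo[ `&` [set w | forall p, p \in l -> p.2 <= X p.1 w]%R.
  rewrite -setIA; congr (_ `&` _); apply/seteqP; split => w /=.
    move=> H; split; first by rewrite in_itv/= andbT; apply: (H (t, b)); rewrite mem_head.
    by move=> q ql; apply: H; rewrite in_cons ql orbT.
  rewrite in_itv/= andbT => -[H1 H2] q; rewrite in_cons => /predU1P[->//|].
  exact: H2.
rewrite (IH t)// integral_mkcondr.
set f := fun y => (\1_(`[b, +oo[) y)%:E * path_prob t l y.
transitivity (\int[P]_(w in A) f (X t w)).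
  apply: eq_integral => w _; rewrite /f /patch indicE.
  rewrite (_ : (w \in X t @^-1` `[b, +oo[) = (X t w \in `[b, +oo[%classic)) //.
  by case: ifP => _; rewrite ?mul1e// mul0e.
(* The density describes no transition from [s] to itself, so a constraint at the current time only
   contributes its indicator. *)
have [ts|ts] := eqVneq t s; first by rewrite /f ts.
apply: (@tangent_op_markov s t A f) => //.
- by rewrite lt_neqAle eq_sym ts.
- apply: emeasurable_funM; first exact/measurable_EFinP.
  exact: measurable_path_prob.
- by move=> y; rewrite mule_ge0 ?path_prob_ge0// lee_fin.
Qed.

(** Events of [G] belong to the past of time 0, so the path formula holds on them. The version is
    written with [x0] instead of [X 0], which equals it only almost surely and need not be
    [G]-measurable. *)
Lemma tangent_cond_prob (l : seq (R * R)) :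
  (forall B, measurable B -> G (x0 @^-1` B)) -> path <=%R 0%R (map fst l) ->
  is_cond_prob P G [set w | forall p, p \in l -> p.2 <= X p.1 w]%R
    (fun w => path_prob 0 l (x0 w)).
Proof.
move=> Gx0 pl; split.
- by move=> w; exact: path_prob_ge0.
- move=> B mB; rewrite -[_ @^-1` _]/(x0 @^-1` (path_prob 0 l @^-1` B)).
  apply: Gx0; rewrite -[_ @^-1` _]setTI; exact: measurable_path_prob.
- move=> A GA; have pA : past 0 A by apply: sub_sigma_algebra; left.
  have mx0 : measurable_fun setT x0.
    by move=> _ B mB; rewrite setTI; apply: Gm; exact: Gx0.
  rewrite (tangent_path_prob (lexx 0%R) pl pA); apply: ge0_ae_eq_integral.
  + exact: Gm.
  + apply: measurable_funTS; exact: measurableT_comp (measurable_path_prob 0 l) mx0.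
  + apply: measurable_funTS.
    exact: measurableT_comp (measurable_path_prob 0 l) (mX (lexx _)).
  + by move=> w _; exact: path_prob_ge0.
  + by move=> w _; exact: path_prob_ge0.
  + by case: hX => _ _ X0 _; apply: filterS X0 => w ->.
Qed.

End tangent_operator.

(** * Scaling of Lebesgue measure, transition density and intensity *)

Section scaling.
Context (R : realType).
Local Open Scope ereal_scope.
Notation mu := (@lebesgue_measure R).

(** Both sides are measures in [A] with the same values on the intervals []a, b]], which
    characterise Lebesgue measure. *)
Lemma lebesgue_measure_dilation (k : R) (A : set R) : (0 < k)%R ->
  measurable A -> mu A = k%:E * mu ( *%R k @^-1` A).
Proof.
move=> k0 mA.
have mk : measurable_fun setT ( *%R k : measurableTypeR R -> measurableTypeR R).
  exact: mulrl_measurable.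
pose nu := mscale (NngNum (ltW k0))
  (measure_function_pushforward__canonical__measure_function_Measure mu mk).
suff -> : mu A = nu A by [].
apply: lebesgue_measure_unique => // _ [[a b] _ <-].
transitivity (k%:E * mu `](a / k)%R, (b / k)%R]%classic); last first.
  rewrite /nu /mscale/= /pushforward; congr (_ * mu _).
  apply/seteqP; split => x /=; rewrite !in_itv/=;
    by rewrite ltr_pdivrMr// ler_pdivlMr// ![(k * x)%R]mulrC.
rewrite !lebesgue_measure_itv/= !lte_fin ltr_pM2r ?invr_gt0//.
case: ifP => _; last by rewrite mule0.
rewrite -!EFinB -EFinM; congr EFin; field; exact: lt0r_neq0.
Qed.

Lemma ge0_integral_dilation (k : R) (D : set R) (f : R -> \bar R) :
  (0 < k)%R -> measurable D -> *%R k @^-1` D = D ->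
  measurable_fun D f -> (forall x, 0 <= f x) ->
  \int[mu]_(x in D) f x = k%:E * \int[mu]_(x in D) f (k * x)%R.
Proof.
move=> k0 mD kD mf f0.
have mk : measurable_fun setT ( *%R k : measurableTypeR R -> measurableTypeR R).
  exact: mulrl_measurable.
pose push := measure_function_pushforward__canonical__measure_function_Measure
  mu mk.
transitivity (\int[mscale (NngNum (ltW k0)) push]_(x in D) f x).
  apply: eq_measure_integral => A mA _.
  exact: lebesgue_measure_dilation.
rewrite ge0_integral_mscale//=; congr (_ * _).
by rewrite (ge0_integral_pushforward mk)// kD.
Qed.

Variables (c : R) (c0 : (0 < c)%R).

Let k0 : (0 < (c ^+ 2)^-1)%R. Proof. by rewrite invr_gt0 exprn_gt0. Qed.

(** Counting powers of [1 / c], the numerator is homogeneous of degree 2 (one from the time step,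
    one from the square root) and the denominator of degree 4. *)
Lemma tangent_density_scale (s t x y : R) : (0 < y)%R ->
  tangent_density (s / c) (t / c) ((c ^+ 2)^-1 * x) ((c ^+ 2)^-1 * y) =
  (c ^+ 2 * tangent_density s t x y)%R.
Proof.
move=> y0; rewrite /tangent_density.
have cn0 : c != 0%R by exact: lt0r_neq0.
have -> : Num.sqrt ((c ^+ 2)^-1 * y) = (Num.sqrt y / c)%R.
  by rewrite sqrtrM ?(ltW k0)// sqrtrV ?sqr_ge0// sqrtr_sqr gtr0_norm// mulrC.
set D := (pi * ((y - x) ^+ 2 + 2 * (x + y) * (t - s) ^+ 2 + (t - s) ^+ 4))%R.
have -> : (pi * (((c ^+ 2)^-1 * y - (c ^+ 2)^-1 * x) ^+ 2 +
    2 * ((c ^+ 2)^-1 * x + (c ^+ 2)^-1 * y) * (t / c - s / c) ^+ 2 +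
    (t / c - s / c) ^+ 4) = (c ^+ 4)^-1 * D)%R by rewrite /D; field.
(* The inverse of [D] is generalised so that [field] puts no condition on [D], which vanishes when
   [s = t] and [x = y]. *)
rewrite invfM invrK; move: (D^-1)%R => iD; by field.
Qed.

Definition scale_constraints (l : seq (R * R)) : seq (R * R) :=
  [seq (p.1 / c, (c ^+ 2)^-1 * p.2)%R | p <- l].

(** In each transition integral the Jacobian of the substitution cancels the factor [c ^+ 2] of the
    density. *)
Lemma path_prob_scale (s : R) (l : seq (R * R)) (x : R) :
  path_prob (s / c) (scale_constraints l) ((c ^+ 2)^-1 * x)%R = path_prob s l x.
Proof.
elim: l s x => [//|[t b] l IH] s x /=.
have E y : \1_(`[((c ^+ 2)^-1 * b)%R, +oo[) ((c ^+ 2)^-1 * y)%R =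
    \1_(`[b, +oo[) y :> R.
  rewrite !indicE; congr ((nat_of_bool _)%:R); apply/idP/idP;
    by rewrite !inE/= !in_itv/= !andbT ler_pM2l.
rewrite (inj_eq (mulIf _)); last by rewrite invr_eq0 lt0r_neq0.
case: (t == s); first by rewrite E IH.
rewrite /tangent_op (@ge0_integral_dilation (c ^+ 2)^-1)//; last first.
- move=> y; rewrite mule_ge0//.
  by rewrite mule_ge0 ?path_prob_ge0// lee_fin.
- apply: measurable_tangent_integrand; apply: emeasurable_funM.
    exact/measurable_EFinP.
  exact: measurable_path_prob.
- apply/seteqP; split => y /=; rewrite !in_itv/= !andbT; by rewrite pmulr_rgt0.
transitivity (((c ^+ 2)^-1)%:E * \int[mu]_(y in `]0%R, +oo[) ((c ^+ 2)%:E *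
    (`|tangent_density s t x y|%:E * ((\1_(`[b, +oo[) y)%:E * path_prob t l y)))).
  congr (_ * _); apply: eq_integral => y; rewrite inE/= in_itv/= andbT => y0.
  rewrite tangent_density_scale// normrM (ger0_norm (sqr_ge0 c)).
  by rewrite E IH EFinM -muleA.
rewrite ge0_integralZl_EFin ?sqr_ge0//.
- by rewrite muleA -EFinM mulVf ?mul1e// expf_neq0// lt0r_neq0.
- move=> y _; rewrite mule_ge0// mule_ge0 ?path_prob_ge0// lee_fin//.
- apply: measurable_tangent_integrand; apply: emeasurable_funM.
    exact/measurable_EFinP.
  exact: measurable_path_prob.
Qed.

(** The Jacobian contributes [c ^+ 2] and the square root in the intensity one more factor [c]. *)
Lemma eta_integral_scale (f : R -> \bar R) :
  measurable_fun setT f -> (forall x, 0 <= f x) ->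
  (c ^+ 3)%:E * eta_integral (fun x => f (c ^+ 2 * x)%R) = eta_integral f.
Proof.
move=> mf f0; rewrite /eta_integral; apply: esym.
have c2 : (0 < c ^+ 2)%R by rewrite exprn_gt0.
have kD : *%R (c ^+ 2) @^-1` `[0%R, +oo[ = `[0%R, +oo[%classic.
  by apply/seteqP; split => y /=; rewrite !in_itv/= !andbT pmulr_rge0.
pose g w := ((3 / 2) * w `^ (1 / 2))%:E * f w.
have g0 w : 0 <= g w by rewrite mule_ge0// lee_fin eta_density_ge0.
transitivity ((c ^+ 2)%:E * \int[mu]_(w in `[0%R, +oo[) g (c ^+ 2 * w)%R).
  apply: ge0_integral_dilation => //; exact: measurable_eta_integrand.
transitivity ((c ^+ 2)%:E * (c%:E * \int[mu]_(w in `[0%R, +oo[)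
    (((3 / 2) * w `^ (1 / 2))%:E * f (c ^+ 2 * w)%R))); last first.
  by rewrite muleA -EFinM -exprSr.
have mfc : measurable_fun setT (fun w => f (c ^+ 2 * w)%R).
  by apply: measurableT_comp => //; exact: mulrl_measurable.
congr (_ * _); rewrite -ge0_integralZl_EFin ?(ltW c0)//; first last.
- exact: measurable_eta_integrand.
- by move=> w _; rewrite mule_ge0// lee_fin eta_density_ge0.
apply: eq_integral => w; rewrite inE/= in_itv/= andbT => w0.
rewrite /g muleA -EFinM; congr (_%:E * _).
rewrite powRM ?sqr_ge0// -[(c ^+ 2)%R]powR_mulrn ?(ltW c0)// -powRrM.
rewrite (_ : 2%:R * (1 / 2) = 1)%R; last by field.
by rewrite powRr1 ?(ltW c0)//; ring.
Qed.

End scaling.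

(** * Two-sided probabilities and the exponent *)

Section start_prob.
Context (R : realType).
Local Open Scope ereal_scope.

(** Sorted because [path_prob] reads constraints in increasing order of time; time 0 goes to the
    forward side, as in [two_sided_path]. *)
Definition forward_constraints (l : seq (R * R)) : seq (R * R) :=
  sort (relpre fst <=%R) [seq p <- l | 0 <= p.1]%R.

Definition backward_constraints (l : seq (R * R)) : seq (R * R) :=
  sort (relpre fst <=%R) [seq (- p.1, p.2) | p <- l & p.1 < 0]%R.

(* Truncating by [1] spares the computation of the total mass of the
   transition density: the truncation is almost surely inactive. *)
Definition start_prob (l : seq (R * R)) (x : R) : \bar R :=
  mine 1 (path_prob 0 (forward_constraints l) x *
          path_prob 0 (backward_constraints l) x).

(** The exponent [Q]. The truncation in [start_prob] makes its integrand nonnegative, as the change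
    of variables requires. *)
Definition eta_exponent (l : seq (R * R)) : \bar R :=
  eta_integral (fun x => 1 - start_prob l x).

Lemma start_prob_ge0 l x : 0 <= start_prob l x.
Proof. by rewrite /start_prob le_min lee01 mule_ge0 ?path_prob_ge0. Qed.

Lemma start_prob_le1 l x : start_prob l x <= 1.
Proof. by rewrite /start_prob ge_min lexx. Qed.

Lemma measurable_start_prob l : measurable_fun setT (start_prob l).
Proof.
apply: measurable_mine => //; apply: emeasurable_funM; exact: measurable_path_prob.
Qed.

Lemma path_forward_constraints l :
  path <=%R 0%R (map fst (forward_constraints l)).
Proof.
rewrite path_min_sorted.
  by rewrite sorted_map; apply: sort_sorted => p q; exact: le_total.
apply/allP => _ /mapP[p + ->]; rewrite mem_sort mem_filter => /andP[p0 _] //.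
Qed.

Lemma path_backward_constraints l :
  path <=%R 0%R (map fst (backward_constraints l)).
Proof.
rewrite path_min_sorted.
  by rewrite sorted_map; apply: sort_sorted => p q; exact: le_total.
apply/allP => _ /mapP[p + ->]; rewrite mem_sort => /mapP[q + ->].
by rewrite mem_filter => /andP[q0 _] /=; rewrite oppr_ge0 ltW.
Qed.

Variables (c : R) (c0 : (0 < c)%R).

Let sort_scale l : sort (relpre fst <=%R) (scale_constraints c l) =
  scale_constraints c (sort (relpre fst <=%R) l).
Proof.
rewrite /scale_constraints sort_map; congr (map _ _); congr (sort _ _).
apply/funext => p; apply/funext => q /=.
by rewrite ler_pM2r// invr_gt0.
Qed.

(** Scaling by a positive [c] fixes time 0 and preserves the signs and the order of times, so it
    commutes with the splitting, reflection and sorting of constraints. *)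
Lemma start_prob_scale l x :
  start_prob (scale_constraints c l) ((c ^+ 2)^-1 * x)%R = start_prob l x.
Proof.
rewrite /start_prob; congr (mine 1 (_ * _)).
- rewrite -[RHS](path_prob_scale c0 0%R) mul0r; congr (path_prob _ _ _).
  rewrite /forward_constraints -sort_scale; congr (sort _ _).
  rewrite /scale_constraints filter_map.
  rewrite (eq_filter (a2 := fun p => 0 <= p.1)%R)// => p /=.
  by rewrite pmulr_lge0// invr_gt0.
- rewrite -[RHS](path_prob_scale c0 0%R) mul0r; congr (path_prob _ _ _).
  rewrite /backward_constraints -sort_scale; congr (sort _ _).
  rewrite /scale_constraints filter_map -!map_comp.
  rewrite (eq_filter (a2 := fun p => p.1 < 0)%R); last first.
    by move=> p /=; rewrite pmulr_llt0// invr_gt0.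
  by apply: eq_map => p /=; rewrite mulNr.
Qed.

Lemma eta_exponent_scale l :
  (c ^+ 3)%:E * eta_exponent (scale_constraints c l) = eta_exponent l.
Proof.
have c2 : (c ^+ 2 != 0)%R by rewrite expf_neq0// lt0r_neq0.
rewrite -[RHS](eta_integral_scale c0).
- congr (_ * eta_integral _); apply/funext => x; congr (1 - _).
  by rewrite -[RHS]start_prob_scale mulrA mulVf// mul1r.
- by apply: emeasurable_funB => //; exact: measurable_start_prob.
- by move=> x; rewrite sube_ge0 ?orbT// start_prob_le1.
Qed.

End start_prob.

(** * Probability that [eta] satisfies finitely many lower bounds *)

Section eta_law.
Context (R : realType) (d : measure_display) (Om : measurableType d)
  (P : probability Om R).
Local Open Scope ereal_scope.

(** On the event [B] where [u > 1], itself in the conditioning sigma-algebra, the integral of [u] is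
    the probability of a subset of [B], hence at most the integral of 1. So [u] and its truncation
    have equal integrals there, and off [B] they coincide. *)
Lemma is_cond_prob_mine1 (S : set (set Om)) (E : set Om) (u : Om -> \bar R) :
  <<s S >> `<=` measurable -> measurable E ->
  is_cond_prob P <<s S >> E u ->
  is_cond_prob P <<s S >> E (fun w => mine 1 (u w)).
Proof.
move=> Sm mE [u0 uS uE].
have mu' : measurable_fun setT u.
  by move=> _ B mB; rewrite setTI; apply: Sm; exact: uS.
have mm : measurable_fun setT (fun w => mine 1 (u w)) by exact: measurable_mine.
split.
- by move=> w; rewrite le_min lee01 u0.
- move=> B mB; apply: (uS (mine 1 @^-1` B)).
  by rewrite -[_ @^-1` _]setTI; apply: measurable_mine.
move=> A SA.
have mA : measurable A by exact: Sm.
pose B := [set w | 1 < u w].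
have SB : <<s S >> B.
  rewrite (_ : B = u @^-1` [set x | 1 < x]).
    apply: uS; rewrite -[[set x | _]]setTI.
    exact: (@emeasurable_fun_o_infty _ _ _ setT id).
  by [].
have mB : measurable B by exact: Sm.
have SAB : <<s S >> (A `&` B) by exact: sigma_genI.
have E1 : \int[P]_(w in A `&` B) mine 1 (u w) = P (A `&` B).
  transitivity (\int[P]_(w in A `&` B) cst 1 w).
    by apply: eq_integral => w /set_mem[_ /ltW w1]; rewrite (min_idPl w1).
  by rewrite integral_cst ?mul1e//; exact: measurableI.
have E2 : \int[P]_(w in A `&` B) u w = P (A `&` B).
  apply/eqP; rewrite eq_le; apply/andP; split.
    rewrite uE//; apply: le_measure; rewrite ?inE; last exact: subIsetl.
      by apply: measurableI => //; exact: measurableI.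
    exact: measurableI.
  apply: (@le_trans _ _ (\int[P]_(w in A `&` B) mine 1 (u w))).
    by rewrite E1.
  apply: ge0_le_integral => //; first exact: measurableI.
  - by move=> w _; rewrite le_min lee01 u0.
  - exact: measurable_funTS.
  - exact: measurable_funTS.
  - by move=> w _; rewrite ge_min lexx orbT.
have split_int (v : Om -> \bar R) : measurable_fun setT v -> (forall w, 0 <= v w) ->
    \int[P]_(w in A) v w =
    \int[P]_(w in A `&` B) v w + \int[P]_(w in A `\` B) v w.
  move=> mv v0; rewrite -ge0_integral_setU//.
  - by rewrite setUIDK.
  - exact: measurableI.
  - exact: measurableD.
  - exact: measurable_funTS.
  - by apply/disj_setPS => w [[_ Bw] [_ /(_ Bw)]].
rewrite -uE// (split_int _ mu' u0) split_int//; last first.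
  by move=> w; rewrite le_min lee01 u0.
rewrite E1 E2; congr (_ + _); apply: eq_integral => w /set_mem[_ wB].
by apply/min_idPr; rewrite leNgt; apply/negP.
Qed.

Context (W : nat -> Om -> R) (Z : nat -> R -> Om -> R).
Hypothesis hZ : eta_construction P W Z.

Let mW n : measurable_fun setT (W n). Proof. by case: hZ => -[[]]. Qed.

Let Gm : sigma_gen [set: nat] W `<=` measurable.
Proof. by apply: sigma_gen_measurable => n _; exact: mW. Qed.

Lemma two_sided_measurable n t : measurable_fun setT (Z n t).
Proof.
have [_ /(_ n)[Xp [Xm [[[mp _ _ _] _] [[mm _ _ _] _] _ ZE]]] _] := hZ.
rewrite (_ : Z n t = two_sided_path Xp Xm t); last by apply/funext => w.
rewrite /two_sided_path; case: (leP 0 t)%R => t0; first exact: mp.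
by apply: mm; rewrite oppr_ge0 ltW.
Qed.

Lemma two_sided_ge0 n t w : (0 <= Z n t w)%R.
Proof.
have [_ /(_ n)[Xp [Xm [[[_ p0 _ _] _] [[_ m0 _ _] _] _ ZE]]] _] := hZ.
rewrite ZE /two_sided_path; case: (leP 0 t)%R => t0; first exact: p0.
by apply: m0; rewrite oppr_ge0 ltW.
Qed.

(** A real infimum is meaningful only for sets bounded below, and nonnegativity supplies the bound.
    A strict inequality for every [n] would not survive the infimum. *)
Lemma le_eta (b t : R) w : (b <= eta Z t w)%R <-> forall n, (b <= Z n t w)%R.
Proof.
split=> [bt n|bZ].
  apply: (le_trans bt); apply: ge_inf; last by exists n.
  by exists 0%R => _ [k _ <-]; exact: two_sided_ge0.
by apply: lb_le_inf => [|_ [n _ <-]//]; exists (Z 0%N t w), 0%N.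
Qed.

Lemma eta_ge0 t w : (0 <= eta Z t w)%R.
Proof. by apply/le_eta => n; exact: two_sided_ge0. Qed.

Lemma measurable_eta t : measurable_fun setT (eta Z t).
Proof.
apply: (measurability _ (RGenCInfty.measurableE R)) => //.
move=> _ [_ [b ->] <-]; rewrite setTI.
rewrite (_ : _ @^-1` _ = \bigcap_n (Z n t @^-1` `[b, +oo[)).
  apply: bigcap_measurable => [|n _]; first by exists 0%N.
  rewrite -[_ @^-1` _]setTI.
  exact: two_sided_measurable.
apply/seteqP; split => w /=.
  by rewrite in_itv/= andbT => /le_eta H n _ /=; rewrite in_itv/= andbT.
move=> H; rewrite in_itv/= andbT; apply/le_eta => n.
by have := H n Logic.I; rewrite /= in_itv/= andbT.
Qed.

(** Given the starting points the two sides are independent, so their path probabilities multiply;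
    negative times are reflected to become times of [Xm]. *)
Lemma two_sided_cond_prob n (l : seq (R * R)) :
  is_cond_prob P (sigma_gen [set: nat] W)
    [set w | forall p, p \in l -> p.2 <= Z n p.1 w]%R
    (fun w => start_prob l (W n w)).
Proof.
have [_ /(_ n)[Xp [Xm [[hp _] [hm _] iX ZE]]] _] := hZ.
have GW B : measurable B -> sigma_gen [set: nat] W (W n @^-1` B).
  exact: sigma_gen_preimage.
pose E (b : bool) := if b
  then [set w | forall p, p \in forward_constraints l -> p.2 <= Xp p.1 w]%R
  else [set w | forall p, p \in backward_constraints l -> p.2 <= Xm p.1 w]%R.
pose f (b : bool) w := if b
  then path_prob 0 (forward_constraints l) (W n w)
  else path_prob 0 (backward_constraints l) (W n w).
have Ef : [set w | forall p, p \in l -> p.2 <= Z n p.1 w]%R =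
    \bigcap_(b in [set` [:: true; false]]) E b.
  apply/seteqP; split => w /=.
    move=> H [] _ p.
      rewrite mem_sort mem_filter => /andP[p0 pl].
      by have := H p pl; rewrite ZE /two_sided_path p0.
    rewrite mem_sort => /mapP[q]; rewrite mem_filter => /andP[q0 ql] ->/=.
    by have := H q ql; rewrite ZE /two_sided_path (lt_geF q0).
  move=> H p pl; rewrite ZE /two_sided_path; case: (leP 0 p.1)%R => p0.
    by apply: (H true) => //; rewrite mem_sort mem_filter p0.
  apply: (H false isT (- p.1, p.2)%R).
  by rewrite mem_sort; apply/mapP; exists p => //; rewrite mem_filter p0.
have EG b : b \in [:: true; false] ->
    sigma_gen [set t : R | 0 <= t]%R (if b then Xp else Xm) (E b).
  move=> _; case: b; apply: sigma_gen_le_all => p /(map_f fst) /=.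
    by move: p.1; apply/allP/(order_path_min le_trans)/path_forward_constraints.
  by move: p.1; apply/allP/(order_path_min le_trans)/path_backward_constraints.
have fE b : b \in [:: true; false] ->
    is_cond_prob P (sigma_gen [set: nat] W) (E b) (f b).
  move=> _; case: b.
    exact: (tangent_cond_prob Gm hp GW (path_forward_constraints l)).
  exact: (tangent_cond_prob Gm hm GW (path_backward_constraints l)).
have := cond_indep_bigcap iX (isT : uniq [:: true; false]) EG fE.
rewrite -Ef => H; apply: is_cond_prob_mine1 => //.
  rewrite (_ : [set w | _] =
      \bigcap_(p in [set` l]) (Z n p.1 @^-1` `[p.2, +oo[)).
    apply: fin_bigcap_measurable; first exact: finite_seq.
    move=> p _; rewrite -[_ @^-1` _]setTI; exact: two_sided_measurable.
  apply/seteqP; split => w /= Hw p pl; have := Hw p pl;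
    by rewrite /= in_itv/= andbT.
rewrite (_ : (fun w => _ * _) = fun w => \prod_(b <- [:: true; false]) f b w)//.
by apply/funext => w; rewrite !big_cons big_nil mule1.
Qed.

Lemma eta_prob (l : seq (R * R)) :
  P [set w | forall p, p \in l -> p.2 <= eta Z p.1 w]%R =
  expeR (- eta_exponent l).
Proof.
pose E n := [set w | forall p, p \in l -> p.2 <= Z n p.1 w]%R.
have mE n : measurable (E n).
  rewrite (_ : E n = \bigcap_(p in [set` l]) (Z n p.1 @^-1` `[p.2, +oo[)).
    apply: fin_bigcap_measurable; first exact: finite_seq.
    move=> p _; rewrite -[_ @^-1` _]setTI; exact: two_sided_measurable.
  apply/seteqP; split => w /= Hw p pl; have := Hw p pl;
    by rewrite /= in_itv/= andbT.
(* Conditional independence applies to the finite intersections [F N], which decrease to the event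
   in question. *)
pose F N := \bigcap_(n in [set` iota 0 N]) E n.
have mF N : measurable (F N).
  by apply: fin_bigcap_measurable => //; exact: finite_seq.
have FE : [set w | forall p, p \in l -> p.2 <= eta Z p.1 w]%R = \bigcap_N F N.
  apply/seteqP; split => w /= H.
    by move=> N _ n _ p pl; move/le_eta: (H p pl); exact.
  move=> p pl; apply/le_eta => n.
  have ni : n \in iota 0 n.+1 by rewrite mem_iota leq0n add0n ltnSn.
  exact: (H n.+1 Logic.I n ni).
have [hW _ iZ] := hZ.
(* The logarithm turns the product of conditional probabilities into a sum over the points; [f] is
   [+oo] where [start_prob] vanishes. *)
pose f x := - lne (start_prob l x).
have f0 x : 0 <= f x by rewrite oppe_ge0 lne_le0 start_prob_le1.
have mf : measurable_fun setT f.
  apply: measurableT_comp => //; apply: measurableT_comp.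
    exact: measurable_lne.
  exact: measurable_start_prob.
have ef x : expeR (- f x) = start_prob l x.
  by rewrite oppeK lneK// in_itv/= start_prob_ge0 leey.
have mfW n : measurable_fun setT (fun w => f (W n w)).
  exact: measurableT_comp mf (mW n).
(* Integrating over the whole space, which lies in the conditioning sigma-algebra, removes the
   conditioning. *)
have PF N : P (F N) = \int[P]_w expeR (- \sum_(0 <= n < N) f (W n w)).
  have [_ _ /(_ setT)] := cond_indep_bigcap (s := iota 0 N) (E := E)
    (f := fun n w => start_prob l (W n w)) iZ (iota_uniq 0 N)
    (fun n _ => sigma_gen_le_all (fun p _ => Logic.I))
    (fun n _ => two_sided_cond_prob n l).
  rewrite setTI => <-; last exact: (@measurableT _ (g_sigma_algebraType _)).
  apply: eq_integral => w _; rewrite expeRN_sum// /index_iota subn0.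
  by apply: eq_bigr => n _; rewrite ef.
have cF : P (F N) @[N --> \oo] --> P (\bigcap_N F N).
  apply: nonincreasing_cvg_mu => //.
  - exact: (le_lt_trans (probability_le1 P (mF _)) (ltry 1)).
  - by apply: bigcap_measurable => //; exists 0%N.
  - move=> m n mn; apply/subsetPset => w H k /=.
    rewrite mem_iota add0n /= => km; apply: H => /=.
    by rewrite mem_iota add0n /= (leq_trans km).
have cI : \int[P]_w expeR (- \sum_(0 <= n < N) f (W n w)) @[N --> \oo] -->
    \int[P]_w expeR (- \sum_(0 <= n <oo) f (W n w)).
  have mS N : measurable_fun setT (fun w => expeR (- \sum_(0 <= n < N) f (W n w))).
    apply: measurableT_comp; first exact: measurable_expeR.
    apply: measurableT_comp => //; exact: emeasurable_sum.
  have cS w : expeR (- \sum_(0 <= n < N) f (W n w)) @[N --> \oo] -->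
      expeR (- \sum_(0 <= n <oo) f (W n w)).
    apply: cvg_expeRN; last exact: is_cvg_nneseries.
    by move=> m n mn; apply: ereal_nondecreasing_series.
  apply: (@dominated_cvg _ Om R P setT measurableT
    (fun N w => expeR (- \sum_(0 <= n < N) f (W n w))) _ (cst 1)) => //.
  - exact: finite_measure_integrable_cst.
  - move=> N w _; rewrite gee0_abs ?expeR_ge0// -expeR0 lee_expeR.
    by rewrite leeNl oppe0 sume_ge0.
rewrite FE -(cvg_lim _ cF)//; under eq_fun do rewrite PF.
rewrite (cvg_lim _ cI)// (poisson_laplace_functional hW mf f0).
congr (expeR (- eta_integral _)); apply/funext => x; by rewrite ef.
Qed.

End eta_law.

(** * Orthants and finite-dimensional distributions *)

Section finite_dimensional_laws.
Context (R : realType).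
Local Open Scope ereal_scope.

(** With a list of constraints instead of a vector of bounds, intersection is concatenation, a
    half-space is a singleton list, and the empty list gives the whole space. *)
Definition orthant m (l : seq ('I_m * R)) : set (m.-tuple R) :=
  [set v | forall p, p \in l -> p.2 <= tnth v p.1]%R.

Lemma measurable_orthant m (l : seq ('I_m * R)) : measurable (orthant l).
Proof.
rewrite (_ : orthant l =
    \bigcap_(p in [set` l]) ((@tnth m R)^~ p.1 @^-1` `[p.2, +oo[)).
  apply: fin_bigcap_measurable; first exact: finite_seq.
  by move=> p _; rewrite -[_ @^-1` _]setTI; apply: measurable_tnth.
by apply/seteqP; split => v /= Hv p pl; have := Hv p pl;
  rewrite /= in_itv/= andbT.
Qed.

Lemma measurable_tuple_orthant m :
  @measurable _ (m.-tuple R) = <<s range (@orthant m) >>.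
Proof.
apply/seteqP; split; last first.
  apply: smallest_sub; first exact: sigma_algebra_measurable.
  by move=> _ [l _ <-]; exact: measurable_orthant.
move=> B mB.
suff : measurable_fun setT
    (id : g_sigma_algebraType (range (@orthant m)) -> m.-tuple R).
  by move=> /(_ measurableT B mB); rewrite setTI.
apply/measurable_fun_tnthP => i.
apply: (measurability _ (RGenCInfty.measurableE R)) => //.
move=> _ [_ [b ->] <-]; rewrite setTI; apply: sub_sigma_algebra.
exists [:: (i, b)] => //; apply/seteqP; split => v /=.
  by move=> /(_ (i, b)); rewrite mem_head in_itv/= andbT; exact.
by rewrite in_itv/= andbT => bv p; rewrite inE => /eqP ->.
Qed.

Lemma setI_closed_orthant m : setI_closed (range (@orthant m)).
Proof.
move=> _ _ [l1 _ <-] [l2 _ <-]; exists (l1 ++ l2) => //.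
apply/seteqP; split => v /=.
  by move=> H; split => p pl; apply: H; rewrite mem_cat pl ?orbT.
by move=> [H1 H2] p; rewrite mem_cat => /orP[/H1|/H2].
Qed.

Context (d d' : measure_display) (Om : measurableType d)
  (P : probability Om R) (Om' : measurableType d') (P' : probability Om' R).

(** Each constraint receives its own coordinate, so a time occurring twice in [l] occupies two
    coordinates of the tuple. *)
Lemma same_fdd_constraints (X : R -> Om -> R) (Y : R -> Om' -> R)
    (l : seq (R * R)) :
  same_fdd P X P' Y ->
  P [set w | forall p, p \in l -> p.2 <= X p.1 w]%R =
  P' [set w | forall p, p \in l -> p.2 <= Y p.1 w]%R.
Proof.
move=> XY; pose t := in_tuple l.
pose B := orthant [seq (i, (tnth t i).2) | i <- enum 'I_(size l)].
have := XY _ [tuple (tnth t i).1 | i < size l] B (measurable_orthant _).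
have E d1 (T : measurableType d1) (V : R -> T -> R) :
    [set w | B [tuple V (tnth [tuple (tnth t i).1 | i < size l] i) w
      | i < size l]] =
    [set w | forall p, p \in l -> p.2 <= V p.1 w]%R.
  apply/seteqP; split => w /=.
    move=> H p /(tnthP t)[i ->].
    have := H (i, (tnth t i).2); rewrite /= !tnth_mktuple; apply.
    by apply: map_f; rewrite mem_enum.
  move=> H _ /mapP[i _ ->] /=; rewrite !tnth_mktuple; apply: H.
  exact: (mem_tnth i t).
by rewrite !E.
Qed.

Lemma same_fdd_of_constraints (X : R -> Om -> R) (Y : R -> Om' -> R) :
  (forall t, measurable_fun setT (X t)) ->
  (forall t, measurable_fun setT (Y t)) ->
  (forall l : seq (R * R),
    P [set w | forall p, p \in l -> p.2 <= X p.1 w]%R =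
    P' [set w | forall p, p \in l -> p.2 <= Y p.1 w]%R) ->
  same_fdd P X P' Y.
Proof.
move=> mX mY XY m t B mB.
pose TX w := [tuple X (tnth t i) w | i < m].
pose TY w := [tuple Y (tnth t i) w | i < m].
have mTX : measurable_fun setT TX.
  apply/measurable_fun_tnthP => i; rewrite (_ : _ \o _ = X (tnth t i))//.
  by apply/funext => w; rewrite /= tnth_mktuple.
have mTY : measurable_fun setT TY.
  apply/measurable_fun_tnthP => i; rewrite (_ : _ \o _ = Y (tnth t i))//.
  by apply/funext => w; rewrite /= tnth_mktuple.
pose PX := measure_function_pushforward__canonical__measure_function_Measure
  P mTX.
pose PY := measure_function_pushforward__canonical__measure_function_Measure
  P' mTY.
suff : PX B = PY B by [].
apply: (measure_unique (range (@orthant m)) (fun=> setT)) => //.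
- exact: measurable_tuple_orthant.
- exact: setI_closed_orthant.
- by move=> _; exists [::] => //; apply/seteqP; split.
- by apply/seteqP; split => // v _; exists 0%N.
- move=> _ [l _ <-].
  have E d1 (T : measurableType d1) (V : R -> T -> R) :
      (fun w => [tuple V (tnth t i) w | i < m]) @^-1` orthant l =
      [set w | forall p, p \in [seq (tnth t q.1, q.2) | q <- l] ->
        p.2 <= V p.1 w]%R.
    apply/seteqP; split => w /=.
      by move=> H _ /mapP[q ql ->]; have := H q ql; rewrite /= tnth_mktuple.
    move=> H q ql /=; rewrite tnth_mktuple.
    by apply: (H (tnth t q.1, q.2)); apply/mapP; exists q.
  by rewrite /PX /PY /= /pushforward !E XY.
- move=> _; apply: (@le_lt_trans _ _ 1); last exact: ltry.
  by rewrite /PX /= /pushforward preimage_setT probability_setT.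
Qed.

Lemma measurable_bigmin (I : Type) (s : seq I) (Y : I -> Om -> R)
    (Y0 : Om -> R) :
  measurable_fun setT Y0 -> (forall i, measurable_fun setT (Y i)) ->
  measurable_fun setT (fun w => \big[Num.min/Y0 w]_(i <- s) Y i w).
Proof.
move=> mY0 mY; elim: s => [|i s IH].
  by under eq_fun do rewrite big_nil.
by under eq_fun do rewrite big_cons; exact: measurable_minr.
Qed.

End finite_dimensional_laws.

(** * Minimum of n scaled copies *)

Lemma scaled_bigmin_ge (R : realType) (c b : R) (n : nat) (y : nat -> R) :
  0 < c -> (0 < n)%N ->
  (b <= c ^+ 2 * \big[Num.min/y 0%N]_(j < n) y j) <->
  (forall j, j \in iota 0 n -> (c ^+ 2)^-1 * b <= y j).
Proof.
move=> c0 n0; rewrite -ler_pdivrMl ?exprn_gt0//; split.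
  move=> /bigmin_geP[_ H] j; rewrite mem_iota add0n => /andP[_ jn].
  exact: (H (Ordinal jn)).
(* The default value of the minimum is the term of index 0, which is present because [0 < n]. *)
move=> H; apply/bigmin_geP; split; first by apply: H; rewrite mem_iota add0n.
by move=> i _; apply: H; rewrite mem_iota add0n leq0n ltn_ord.
Qed.

Lemma expeR_prod_const (R : realType) (n : nat) (x : \bar R) : (0 <= x)%E ->
  (\prod_(j <- iota 0 n) expeR (- x) = expeR (- (n%:R%:E * x)))%E.
Proof.
move=> x0; rewrite -expeRN_sum//; congr (expeR (- _)).
by rewrite big_const_seq count_predT size_iota iter_addr_0 mule_natl.
Qed.

Theorem mainTheorem4 (R : realType) (d : measure_display)
    (Om : measurableType d) (P : probability Om R)
    (W : nat -> Om -> R) (Z : nat -> R -> Om -> R)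
    (hZ : eta_construction P W Z) :
  semi_min_stable P (eta Z) (3 / 2) (1 / 3).
Proof.
split; first by split; rewrite ?divr_gt0 ?divr_ge0.
- exact: measurable_eta hZ.
- exact: eta_ge0 hZ.
move=> d' Om' P' Y [mY etaY iY] n n0.
set c := n%:R `^ (1 / 3).
have nR : (0 : R) < n%:R by rewrite ltr0n.
have c0 : 0 < c by exact: powR_gt0.
(* The inverse of [3 / 2] is twice [1 / 3], so the space factor is the square of the time factor
   [c], as the transition density requires; the cube of [c] is the number of copies. *)
have c2 : n%:R `^ (3 / 2)^-1 = c ^+ 2.
  by rewrite -powR_mulrn ?(ltW c0)// -powRrM; congr powR; field.
have c3 : c ^+ 3 = n%:R.
  rewrite -powR_mulrn ?(ltW c0)// -powRrM (_ : 1 / 3 * 3%:R = 1); last by field.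
  by rewrite powRr1 ?(ltW nR).
rewrite c2; apply: same_fdd_of_constraints.
- exact: measurable_eta hZ.
- move=> t; apply: measurable_funM => //.
  exact: (@measurable_bigmin _ _ _ _ _ (fun j : 'I_n => Y j (t / c))).
move=> l; set l' := scale_constraints c l.
pose E j := [set w | forall p, p \in l' -> p.2 <= Y j p.1 w].
(* The scaled minimum satisfies the constraints [l] exactly when each of the [n] copies satisfies
   the scaled constraints [l']. *)
rewrite (_ : [set w | _] = \bigcap_(j in [set` iota 0 n]) E j); last first.
  apply/seteqP; split => w /=.
    move=> H j /= jn _ /mapP[p pl ->] /=.
    by have /(scaled_bigmin_ge _ (fun j => Y j _ w) c0 n0) := H p pl; exact.
  move=> H p pl; apply/(scaled_bigmin_ge _ (fun j => Y j _ w) c0 n0) => j jn.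
  by apply: (H j jn (p.1 / c, (c ^+ 2)^-1 * p.2)); exact: map_f.
rewrite (indep_bigcap iY) ?iota_uniq//; last first.
  by move=> j _; exact: sigma_gen_le_all.
(* Each event involves finitely many times of one copy, so its probability is read off [eta] through
   the finite-dimensional distributions. *)
under eq_bigr do rewrite -(same_fdd_constraints l' (etaY _)) (eta_prob hZ).
rewrite expeR_prod_const; last first.
  apply: integral_ge0 => x _; rewrite mule_ge0 ?lee_fin ?eta_density_ge0//.
  by rewrite sube_ge0 ?orbT// start_prob_le1.
by rewrite -c3 (eta_exponent_scale c0) (eta_prob hZ).
Qed.
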